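(* Let $d=2$ and $Q^2=(-\pi,\pi]^2$. There is a constant $c>0$ such that for every integer $n\geq 2$ the following holds: if $X_1,\ldots,X_n,Y_1,\ldots,Y_n$ are independent random variables, each with the uniform distribution $\frac{dx}{(2\pi)^2}$ on $Q^2$, and $\mu_n=\frac1n\sum_{k=1}^n\delta_{X_k}$, $\nu_n=\frac1n\sum_{k=1}^n\delta_{Y_k}$, then $$ \mathbb{E}\big(\widetilde{\mathrm{W}}_1(\mu_n,\nu_n)\big)\ \geq\ c\,\sqrt{\frac{\log n}{n}}. $$
   Context: On $(-\pi,\pi]$ put $\rho(x,y)=\min\{|x-y|,\,2\pi-|x-y|\}$, and on $Q^2=(-\pi,\pi]^2$ put $\rho_2(x,y)=\big(\rho(x_1,y_1)^2+\rho(x_2,y_2)^2\big)^{1/2}$ (the geodesic distance of the flat torus). For Borel probability measures $\mu,\nu$ on $Q^2$, $\widetilde{\mathrm{W}}_1(\mu,\nu)=\inf_\lambda\int_{Q^2}\int_{Q^2}\rho_2(x,y)\,d\lambda(x,y)$, the infimum being over all probability measures $\lambda$ on $Q^2\times Q^2$ with marginals $\mu$ and $\nu$. *)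

(* Defs.v *)
From HB Require Import structures.
From mathcomp Require Import all_boot all_order all_algebra.
From mathcomp Require Import all_classical all_reals all_analysis.

Set Implicit Arguments.
Unset Strict Implicit.
Unset Printing Implicit Defensive.

Import Order.TTheory GRing.Theory Num.Theory.
Import numFieldNormedType.Exports.

Local Open Scope classical_set_scope.
Local Open Scope ring_scope.

Section torus.
Context {R : realType}.

Definition Q2 : set (R * R) := `]- pi, pi] `*` `]- pi, pi].

Definition rho (x y : R) : R := Num.min `|x - y| (2 * pi - `|x - y|).

Definition rho2 (x y : R * R) : R :=
  Num.sqrt (rho x.1 y.1 ^+ 2 + rho x.2 y.2 ^+ 2).

(* Measures on Q2 are represented by Borel measures on R * R that are
   concentrated on Q2; a coupling of two such measures is then concentrated on
   Q2 `*` Q2. *)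
Definition coupling (mu nu : {measure set (R * R) -> \bar R})
    (lambda : probability ((R * R) * (R * R))%type R) : Prop :=
  (forall A, measurable A -> pushforward lambda fst A = mu A) /\
  (forall A, measurable A -> pushforward lambda snd A = nu A).

Definition W1 (mu nu : {measure set (R * R) -> \bar R}) : \bar R :=
  ereal_inf [set (\int[lambda]_(z in Q2 `*` Q2) (rho2 z.1 z.2)%:E)%E
            | lambda in coupling mu nu].

End torus.

Section empirical.
Local Open Scope ereal_scope.
Context d (T : measurableType d) (R : realType) (n : nat) (x : 'I_n -> T).

Definition empirical_measure (A : set T) : \bar R :=
  (n%:R^-1)%:E * \sum_(k < n) \d_(x k) A.

Let empirical0 : empirical_measure set0 = 0.
Proof.
by rewrite /empirical_measure big1 ?mule0 // => k _; rewrite measure0.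
Qed.

Let empirical_ge0 A : 0 <= empirical_measure A.
Proof. by apply: mule_ge0; [rewrite lee_fin | apply: sume_ge0]. Qed.

Let empirical_sigma_additive : semi_sigma_additive empirical_measure.
Proof.
move=> F mF tF mUF.
rewrite [X in X @ _ --> _](_ : _ = (fun m =>
  (n%:R^-1)%:E * \sum_(k < n) \sum_(0 <= i < m) \d_(x k) (F i))); last first.
  apply/funext => m; rewrite /empirical_measure -ge0_sume_distrr; last first.
    by move=> i _; exact: sume_ge0.
  by rewrite exchange_big.
apply: cvgeZl => //; apply: cvg_nnesum => [k _|k _].
  by near=> m; exact: sume_ge0.
exact: measure_semi_sigma_additive.
Unshelve. all: by end_near. Qed.

HB.instance Definition _ := isMeasure.Build _ _ _ empirical_measure
  empirical0 empirical_ge0 empirical_sigma_additive.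

End empirical.

Section random_variables.
Local Open Scope ereal_scope.
Context d (T : measurableType d) (R : realType) (P : probability T R).

Definition mutually_independent d' (T' : measurableType d') (I : finType)
    (X : I -> {RV P >-> T'}) : Prop :=
  forall (J : {set I}) (B : I -> set T'), (forall i, measurable (B i)) ->
    P (\bigcap_(i in [set` J]) (X i @^-1` B i)) =
    \prod_(i in J) P (X i @^-1` B i).

Definition uniform_on_Q2 (X : {RV P >-> (R * R)%type}) : Prop :=
  (forall w, Q2 (X w)) /\
  (forall A, measurable A -> distribution P X A =
    (((2 * pi) ^+ 2)^-1)%:E *
      (lebesgue_measure \x lebesgue_measure) (A `&` Q2)).

End random_variables.

(* Main.v *)
Require Import Defs.
From HB Require Import structures.
From mathcomp Require Import all_boot all_order all_algebra.
From mathcomp Require Import all_classical all_reals all_analysis.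
From mathcomp Require Import zify ring lra complex measurable_realfun.

Set Implicit Arguments.
Unset Strict Implicit.
Unset Printing Implicit Defensive.

Import Order.TTheory GRing.Theory Num.Theory.
Import numFieldNormedType.Exports.

Local Open Scope classical_set_scope.
Local Open Scope ring_scope.

(** The bound is proved by duality: a function f on the torus with Lipschitz
constant L forces the cost of every coupling of the two empirical measures to be at
least 1/L times the difference of the means of f over the points X_k and over the
points Y_k (coupling_cost). For each sample a function f is constructed such that
this quantity is of order sqrt(log n / n) on average.

The torus is cut into a very fine grid of square cells, and f depends on the cell
only. For each of N scales, N of order log n, the grid is divided into square
blocks, the block of the finest scale containing about one point of each sample.
Every block carries a product of two tents, of height proportional to its side, and
f is a sum of these bumps over all blocks of all scales, with coefficients 1, -1
or 0. The sign is that of the discrepancy of the bump, that is of the difference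
of its sums over the X_k and over the Y_k. The absolute value of the discrepancy
has mean of order (height) * sqrt(n * area of the block), and the sum of these means
over the blocks of one scale is of order sqrt n times the side of the torus, so the
N scales together give N * sqrt n.

The slopes of f have size sqrt N and not N at most places. Indeed the horizontal
increments of a tent are a Rademacher function of the next scale (tent_step),
so along a row the increments of the successive scales are orthogonal for all
choices of the coefficients (slope_energy_row), and likewise along a column. A block
in which the previous scales have already produced a slope exceeding some lam of
order sqrt N gets the coefficient 0 (stopped_signs). Hence f has Lipschitz
constant of order sqrt N (slope_le). Since slopes oscillate by at most 1 on a block
(slope_osc), Chebyshev's inequality bounds the number of stopped blocks by
a small proportion of all blocks of each scale, for every sample (count_steep).
It is therefore harmless that the stopped blocks depend on the sample: the absolute
value |S| of a discrepancy is bounded from below by the bounded quantity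
(1 - cos(t S)) / t, and the loss of this quantity on the stopped blocks is small
(stopped_disc). The mean of cos(t S) is a power of
the characteristic function of one difference and is bounded away from 1
(sum_cos_ffun, bump_deviation). Altogether the gain is N * sqrt n / sqrt N, which
is of order sqrt(n log n), before the division by n.

Since f depends on the cells, only the finitely many configurations of cells of the
2n points matter, and these are equally likely (prob_cells). Replacing the points by
their cells costs at most the width of a cell, which is negligible for a fine
grid. *)

(** * Dyadic sums of tents with bounded coefficients *)

Section tent.
Context {R : realFieldType}.

(** Distance from x to the multiples of l. *)
Definition tent (l x : nat) : R := (minn (x %% l) (l - x %% l))%:R.

Lemma tent_ge0 l x : 0 <= tent l x. Proof. exact: ler0n. Qed.

Lemma tent_dvd l x : (l %| x)%N -> tent l x = 0.
Proof. by move=> /eqP lx; rewrite /tent lx min0n. Qed.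

Lemma tent_le l x : (0 < l)%N -> tent l x / l%:R <= 2^-1.
Proof.
move=> l0; have lR : 0 < l%:R :> R by rewrite ltr0n.
rewrite ler_pdivrMr// mulrC ler_pdivlMr// -natrM ler_nat.
have := ltn_pmod x l0; lia.
Qed.

Lemma tent_ratio_ge0 l x : 0 <= tent l x / l%:R.
Proof. by rewrite divr_ge0// ler0n. Qed.

(** The increments of a tent are a Rademacher function of the next finer dyadic
scale; the orthogonality of the scales rests on this. *)
Lemma tent_step h x : (0 < h)%N ->
  tent h.*2 x.+1 - tent h.*2 x = (-1) ^+ (x %/ h).
Proof.
move=> h0.
have rh := ltn_pmod x h0.
have e := divn_eq x h.
have e2 := odd_double_half (x %/ h).
rewrite -signr_odd.
set q := (x %/ h)%N in e e2 *; set r := (x %% h)%N in e rh.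
have xE : (x %% h.*2 = odd q * h + r)%N.
  have -> : x = (q./2 * h.*2 + (odd q * h + r))%N by rewrite e -{1}e2; lia.
  rewrite modnMDl modn_small//; case: (odd q); lia.
have x1E : (x.+1 %% h.*2 = (odd q * h + r.+1) %% h.*2)%N.
  have -> : x.+1 = (q./2 * h.*2 + (odd q * h + r.+1))%N by rewrite e -{1}e2; lia.
  by rewrite modnMDl.
rewrite /tent xE x1E; case: (odd q) {xE x1E e2}; rewrite ?expr1 ?expr0.
  have [rh1|rh1] := ltnP r.+1 h.
    rewrite modn_small; last lia.
    rewrite (minn_idPr _); last lia.
    rewrite (minn_idPr _); last lia.
    have -> : (h.*2 - (true * h + r) = (h.*2 - (true * h + r.+1)).+1)%N by lia.
    by rewrite -natr1 opprD addrA subrr add0r.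
  have -> : (true * h + r.+1 = h.*2)%N by lia.
  rewrite modnn min0n (minn_idPr _); last lia.
  have -> : (h.*2 - (true * h + r) = 1)%N by lia.
  by rewrite sub0r.
rewrite modn_small; last lia.
rewrite (minn_idPl _); last lia.
rewrite (minn_idPl _); last lia.
by rewrite !mul0n !add0n -natr1 addrC addrA (addrC (- _)) subrr add0r.
Qed.

Lemma sum_blocks n h (G : nat -> nat -> R) :
  \sum_(0 <= x < n * h) G (x %/ h)%N x =
  \sum_(0 <= p < n) \sum_(p * h <= x < p.+1 * h) G p x.
Proof.
rewrite big_nat_mul; apply: eq_bigr => p _.
apply: eq_big_nat => x /andP[px xp].
have h0 : (0 < h)%N by case: h px xp => [|//]; rewrite !muln0; lia.
suff -> : (x %/ h = p)%N by [].
by apply/eqP; rewrite eqn_leq leq_divRL// px andbT -ltnS ltn_divLR.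
Qed.

Lemma sum_block n h (G : nat -> R) :
  \sum_(0 <= x < n * h) G (x %/ h)%N = \sum_(0 <= p < n) G p *+ h.
Proof.
rewrite (sum_blocks n h (fun p _ => G p)); apply: eq_bigr => p _.
by rewrite sumr_const_nat mulSn addnK.
Qed.

(** The Rademacher factor takes both signs equally often on each block of length
2h, where the other factor is constant. *)
Lemma sum_rademacher m h (A : nat -> R) :
  \sum_(0 <= x < m * h.*2) A (x %/ h.*2)%N * (-1) ^+ (x %/ h) = 0.
Proof.
have -> : (m * h.*2 = m * 2 * h)%N by lia.
rewrite (eq_bigr (fun x => (fun p => A (p %/ 2)%N * (-1) ^+ p) (x %/ h)%N)).
  rewrite (sum_block _ _ (fun p => A (p %/ 2)%N * (-1) ^+ p)) big_nat_mul big1// => i _.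
  have -> : (i.+1 * 2 = (i * 2).+2)%N by lia.
  rewrite big_nat_recl// big_nat1.
  have -> : ((i * 2).+1 %/ 2 = i)%N by lia.
  by rewrite mulnK//= exprS mulN1r mulrN mulNrn subrr.
by move=> x _; rewrite -divnMA -muln2.
Qed.

End tent.

Section multiscale.
Context {R : realFieldType}.
Variables (l : nat -> nat) (N : nat).
Hypothesis lS : forall k, (k < N)%N -> l k = (l k.+1).*2.
Hypothesis lN : (0 < l N)%N.
Implicit Type c : nat -> nat -> nat -> R.

(** On a block of side l j the function attached to it is a product of two tents,
normalised to have slopes of order one. The blocks of all scales are handled at
once: the quotients by l j name the block containing the point. *)
Definition bumps c k x y : R :=
  \sum_(j < k) c j (x %/ l j)%N (y %/ l j)%N *
    (tent (l j) x * (tent (l j) y / (l j)%:R)).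

(** The horizontal increment of bumps, see bumps_step. *)
Definition slope c k x y : R :=
  \sum_(j < k) c j (x %/ l j)%N (y %/ l j)%N *
    ((-1) ^+ (x %/ l j.+1) * (tent (l j) y / (l j)%:R)).

Definition transpose c : nat -> nat -> nat -> R := fun k p q => c k q p.

Lemma bumps_transpose c k x y : bumps (transpose c) k y x = bumps c k x y.
Proof. by apply: eq_bigr => j _; rewrite /transpose; congr *%R; ring. Qed.

Lemma l_gt0 k : (k <= N)%N -> (0 < l k)%N.
Proof.
move=> kN; have : forall i, (i <= N)%N -> (0 < l (N - i))%N.
  elim => [|i IH] iN; first by rewrite subn0.
  have iN' := ltnW iN; rewrite lS; last lia.
  by rewrite -subSn// subSS double_gt0 IH.
by move=> /(_ (N - k)%N (leq_subr _ _)); rewrite subKn.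
Qed.

Lemma l_gt0R k : (k <= N)%N -> 0 < (l k)%:R :> R.
Proof. by move=> kN; rewrite ltr0n l_gt0. Qed.

Lemma block_coarsen j k x x' : (j <= k)%N -> (k <= N)%N ->
  (x %/ l k = x' %/ l k)%N -> (x %/ l j = x' %/ l j)%N.
Proof.
elim: k => [|k IH]; first by rewrite leqn0 => /eqP ->.
rewrite leq_eqVlt => /orP[/eqP->//|jk] kN e.
apply: IH => //; first exact: ltnW.
by rewrite lS// -muln2 !divnMA e.
Qed.

(** A change of block between x and x+1 is harmless, because the tents vanish at
the left end of each block. *)
Lemma bumps_step c k x y : (k <= N)%N ->
  bumps c k x.+1 y - bumps c k x y = slope c k x y.
Proof.
move=> kN; rewrite -sumrB; apply: eq_bigr => j _.
have jN : (j < N)%N by apply: leq_trans kN.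
rewrite -(tent_step x (l_gt0 jN)) -lS//.
suff -> : c j (x.+1 %/ l j)%N (y %/ l j)%N * (tent (l j) x.+1 * (tent (l j) y / (l j)%:R))
   = c j (x %/ l j)%N (y %/ l j)%N * (tent (l j) x.+1 * (tent (l j) y / (l j)%:R)) by ring.
rewrite divnS ?l_gt0 ?(ltnW jN)//.
have [lx|_] := boolP (l j %| x.+1)%N; last by rewrite add0n.
by rewrite tent_dvd// !mul0r !mulr0.
Qed.

Lemma slopeS c k x y : slope c k.+1 x y = slope c k x y +
  c k (x %/ l k)%N (y %/ l k)%N *
    ((-1) ^+ (x %/ l k.+1) * (tent (l k) y / (l k)%:R)).
Proof. by rewrite /slope big_ord_recr. Qed.

Lemma slope_block c k x x' y : (k <= N)%N -> (x %/ l k = x' %/ l k)%N ->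
  slope c k x y = slope c k x' y.
Proof.
move=> kN e; apply: eq_bigr => j _.
have jk := ltn_ord j.
rewrite (@block_coarsen j k x x')//; last exact: ltnW.
by rewrite (@block_coarsen j.+1 k x x').
Qed.

Section bounded.
Variable c : nat -> nat -> nat -> R.
Hypothesis c1 : forall j p q, `|c j p q| <= 1.

Lemma tent_lip k y y' : (k <= N)%N -> (y %/ l k = y' %/ l k)%N ->
  `|tent (l k) y - tent (l k) y'| <= `|y%:R - y'%:R| :> R.
Proof.
move=> kN e; wlog yy : y y' e / (y <= y')%N => [wl|].
  have [/wl->//|/ltnW/wl] := leqP y y'.
  by rewrite distrC (distrC y'%:R); apply.
have l0 := l_gt0 kN; have -> : `|y%:R - y'%:R| = (y' - y)%:R :> R.
  by rewrite distrC natrB// ger0_norm// subr_ge0 ler_nat.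
have [e1 e2] := (divn_eq y (l k), divn_eq y' (l k)).
rewrite -e in e2; have := ltn_pmod y l0; have := ltn_pmod y' l0 => h1 h2.
rewrite ler_norml /tent lerBlDr lerNl opprB lerBlDr -!natrD !ler_nat.
by move: e1 e2; set u := (y %/ l k * l k)%N => e1 e2; lia.
Qed.

(** The slope changes with y only through the tents of the coarser scales, whose
contributions form a geometric series dominated by the last scale. *)
Lemma slope_osc_lip k x x' y y' : (k <= N)%N ->
  (x %/ l k = x' %/ l k)%N -> (y %/ l k = y' %/ l k)%N ->
  `|slope c k x y - slope c k x' y'| * (l k)%:R <= `|y%:R - y'%:R|.
Proof.
elim: k => [|k IH] kN ex ey.
  by rewrite /slope !big_ord0 subr0 normr0 mul0r.
have ex' := block_coarsen (leqnSn k) kN ex.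
have ey' := block_coarsen (leqnSn k) kN ey.
have {}IH := IH (ltnW kN) ex' ey'.
rewrite !slopeS ex' ex ey'.
set C := c _ _ _; set s := (-1) ^+ _.
have lk := l_gt0R (ltnW kN).
have lE : (l k)%:R = 2 * (l k.+1)%:R :> R by rewrite lS// -muln2 natrM mulrC.
have T := tent_lip (ltnW kN) ey'.
have -> : slope c k x y + C * (s * (tent (l k) y / (l k)%:R)) -
  (slope c k x' y' + C * (s * (tent (l k) y' / (l k)%:R))) =
  (slope c k x y - slope c k x' y') +
    C * s * ((tent (l k) y - tent (l k) y') / (l k)%:R).
  by field; rewrite gt_eqF.
set a := _ - _ in IH *.
have b1 : `|C * s * ((tent (l k) y - tent (l k) y') / (l k)%:R)| * (l k)%:R
     <= `|y%:R - y'%:R|.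
  rewrite !normrM normrV ?unitfE ?gt_eqF// (gtr0_norm lk) /s normrX normrN1 expr1n mulr1.
  rewrite mulrA -[leLHS]mulrA mulVf ?gt_eqF// mulr1.
  rewrite -[leRHS]mul1r; apply: ler_pM => //; exact: c1.
have := ler_normD a (C * s * ((tent (l k) y - tent (l k) y') / (l k)%:R)).
move: b1 IH; rewrite lE; set t := `|C * s * _|; set A := `|a|; set G := `|_ + _|.
have l1 := l_gt0R kN; nra.
Qed.

Lemma slope_osc k x x' y y' : (k <= N)%N ->
  (x %/ l k = x' %/ l k)%N -> (y %/ l k = y' %/ l k)%N ->
  `|slope c k x y - slope c k x' y'| <= 1.
Proof.
move=> kN ex ey; have l0 := l_gt0R kN.
rewrite -(ler_pM2r l0) mul1r; apply: le_trans (slope_osc_lip kN ex ey) _.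
have [e1 e2] := (divn_eq y (l k), divn_eq y' (l k)).
rewrite -ey in e2; have := ltn_pmod y (l_gt0 kN); have := ltn_pmod y' (l_gt0 kN).
move=> h1 h2; rewrite ler_norml lerBlDr lerNl opprB lerBlDr -!natrD !ler_nat.
by move: e1 e2; set u := (y %/ l k * l k)%N => e1 e2; lia.
Qed.

(** Along a row the terms of the slope form a martingale in the position x: the
term of scale k is a Rademacher function of scale k+1 times a function of the
block of scale k. The cross terms vanish for all choices of the coefficients, so
the squares add up. *)
Lemma slope_energy_row m k y : (k <= N)%N ->
  \sum_(0 <= x < m * l 0) slope c k x y ^+ 2 <= (m * l 0)%:R * k%:R / 4.
Proof.
elim: k => [|k IH] kN.
  by rewrite big1 ?mulr0 ?mul0r// => x _; rewrite /slope big_ord0 expr0n.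
have {}IH := IH (ltnW kN).
have lk0 := l_gt0 (ltnW kN).
have [m' mE] : exists m', (m * l 0 = m' * l k)%N.
  elim: k kN {IH lk0} => [|k IH] kN; first by exists m.
  have [m' ->] := IH (ltnW kN); exists (m' * 2)%N; rewrite lS ?(ltnW kN)//; lia.
(* The factor of the Rademacher function in the cross term, as a function of the block. *)
pose A p := slope c k (p * l k) y * c k p (y %/ l k)%N * (tent (l k) y / (l k)%:R).
have AE x : slope c k x y * (c k (x %/ l k)%N (y %/ l k)%N *
   ((-1) ^+ (x %/ l k.+1) * (tent (l k) y / (l k)%:R))) = 
   A (x %/ l k)%N * (-1) ^+ (x %/ l k.+1).
  rewrite /A (@slope_block c k x (x %/ l k * l k)%N) ?(ltnW kN)//; first by ring.
  by rewrite mulnK.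
rewrite (eq_bigr (fun x => slope c k x y ^+ 2 + 2 * (A (x %/ l k)%N * (-1) ^+ (x %/ l k.+1)) +
  (c k (x %/ l k)%N (y %/ l k)%N * ((-1) ^+ (x %/ l k.+1) * (tent (l k) y / (l k)%:R))) ^+ 2));
  last by move=> x _; rewrite slopeS -AE; ring.
rewrite !big_split/= -mulr_sumr.
have -> : \sum_(0 <= x < m * l 0) A (x %/ l k)%N * (-1) ^+ (x %/ l k.+1) = 0.
  by rewrite mE lS// sum_rademacher.
have : \sum_(0 <= x < m * l 0) (c k (x %/ l k)%N (y %/ l k)%N *
    ((-1) ^+ (x %/ l k.+1) * (tent (l k) y / (l k)%:R))) ^+ 2
   <= \sum_(0 <= x < m * l 0) 4^-1.
  apply: ler_sum => x _; rewrite !exprMn sqrr_sign mul1r.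
  rewrite -[leRHS]mul1r; apply: ler_pM; rewrite ?sqr_ge0//.
  - by rewrite -exprMn sqr_ge0.
  - by rewrite -[leLHS]real_normK ?num_real// expr_le1.
  rewrite -exprMn (_ : 4^-1 = 2^-1 ^+ 2 :> R); last by field.
  by rewrite lerXn2r ?nnegrE ?invr_ge0// ?tent_ratio_ge0 ?tent_le.
rewrite sumr_const_nat subn0 -[4^-1 *+ _]mulr_natr -[k.+1]addn1 natrD mulr0 addr0 => h.
by apply: le_trans (lerD IH h) _; rewrite le_eqVlt; apply/orP; left; apply/eqP; ring.
Qed.

(** Chebyshev: if the slope exceeds lam at the corner of a block, it exceeds lam - 1
on the whole block by slope_osc, which costs energy. *)
Lemma count_steep (lam : R) k B m : (k <= N)%N -> (B * l k = m * l 0)%N -> 1 <= lam ->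
  (\sum_(0 <= p < B) \sum_(0 <= q < B)
    (lam < `|slope c k (p * l k) (q * l k)|)%R%:R) * (lam - 1) ^+ 2
  <= B%:R ^+ 2 * k%:R / 4.
Proof.
move=> kN BE lam1.
have l0 := l_gt0R kN.
pose G p q : R := (lam < `|slope c k (p * l k) (q * l k)|)%R%:R * (lam - 1) ^+ 2.
have GE x y : G (x %/ l k)%N (y %/ l k)%N <= slope c k x y ^+ 2.
  rewrite /G; case: ltP => [h|_]; last by rewrite mul0r sqr_ge0.
  have := @slope_osc k (x %/ l k * l k)%N x (y %/ l k * l k)%N y kN.
  rewrite !mulnK ?l_gt0// => /(_ erefl erefl) osc.
  rewrite mul1r -(real_normK (num_real (slope c k x y))).
  rewrite lerXn2r ?nnegrE ?subr_ge0//.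
  set a := slope _ _ _ _ in h osc; set b := slope _ _ _ _ in osc *.
  have := ler_normD (a - b) b; rewrite subrK => h2; lra.
have : \sum_(0 <= y < B * l k) \sum_(0 <= x < B * l k) G (x %/ l k)%N (y %/ l k)%N
   <= \sum_(0 <= y < B * l k) (B * l k)%:R * k%:R / 4.
  apply: ler_sum => y _; apply: (@le_trans _ _ (\sum_(0 <= x < B * l k) slope c k x y ^+ 2)).
    by apply: ler_sum.
  by rewrite BE; exact: slope_energy_row.
rewrite (eq_bigr (fun y => (fun q => \sum_(0 <= p < B) G p q *+ l k) (y %/ l k)%N)); last first.
  by move=> y _; rewrite (sum_block B (l k) (fun p => G p (y %/ l k)%N)).
rewrite (sum_block B (l k) (fun q => \sum_(0 <= p < B) G p q *+ l k)) sumr_const_nat subn0.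
rewrite (eq_bigr (fun q => (\sum_(0 <= p < B) G p q) * (l k)%:R ^+ 2)); last first.
  by move=> q _; rewrite sumrMnl -mulrnA -[LHS]mulr_natr natrM expr2.
rewrite -mulr_suml -[_ *+ (B * l k)]mulr_natr natrM.
have -> : B%:R * (l k)%:R * k%:R / 4 * (B%:R * (l k)%:R) = B%:R ^+ 2 * k%:R / 4 * (l k)%:R ^+ 2 :> R.
  by ring.
rewrite ler_pM2r ?exprn_gt0// => h; apply: le_trans h.
rewrite mulr_suml exchange_big/=.
by apply: ler_sum => q _; rewrite mulr_suml.
Qed.

(** A block receives a nonzero coefficient only while the slope is at most lam at its
corner, hence at most lam + 1 on the block, and one more scale adds at most 1;
a block with coefficient 0 leaves the slope as it was. *)
Lemma slope_le (lam : R) k x y : (k <= N)%N -> 0 <= lam ->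
  (forall k p q, c k p q != 0 -> `|slope c k (p * l k) (q * l k)| <= lam) ->
  `|slope c k x y| <= lam + 2.
Proof.
move=> + lam0 stop; elim: k => [|k IH] kN.
  by rewrite /slope big_ord0 normr0; lra.
have {}IH := IH (ltnW kN); rewrite slopeS.
have [->|/stop h] := eqVneq (c k (x %/ l k)%N (y %/ l k)%N) 0.
  by rewrite mul0r addr0.
have := @slope_osc k (x %/ l k * l k)%N x (y %/ l k * l k)%N y (ltnW kN).
rewrite !mulnK ?l_gt0 ?(ltnW kN)// => /(_ erefl erefl) osc.
set C := c _ _ _; set a := slope _ _ _ _ in h osc; set b := slope _ _ _ _ in osc *.
have := ler_normD (b - a) a; rewrite subrK distrC => h2.
apply: le_trans (ler_normD _ _) _.
have : `|C * ((-1) ^+ (x %/ l k.+1) * (tent (l k) y / (l k)%:R))| <= 1.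
  rewrite !normrM normrX normrN1 expr1n mul1r (ger0_norm (tent_ge0 _ _)) normfV normr_nat.
  rewrite -[leRHS]mul1r; apply: ler_pM; rewrite ?tent_ratio_ge0//; first exact: c1.
  by apply: le_trans (tent_le _ (l_gt0 (ltnW kN))) _; lra.
lra.
Qed.

End bounded.

Lemma slope_prefix c c' k x y : (forall j, (j < k)%N -> c j = c' j) ->
  slope c k x y = slope c' k x y.
Proof. by move=> e; apply: eq_bigr => j _; rewrite e. Qed.

(** The slopes are tested at the corner of the block only, which suffices since they
oscillate by at most 1 on it. *)
Definition flat (lam : R) c k p q :=
  (`|slope c k (p * l k) (q * l k)| <= lam) &&
  (`|slope (transpose c) k (q * l k) (p * l k)| <= lam).

(** The coefficients of scale k depend on the slopes produced by the scales below k;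
the equation is solved by recursion on k, on the families truncated at k. *)
Lemma stopped_signs (lam : R) (S : nat -> nat -> nat -> R) : exists c,
  forall k p q, c k p q = if flat lam c k p q then Num.sg (S k p q) else 0.
Proof.
(* C k holds the coefficients of the scales below k. *)
pose rule c k p q : R := if flat lam c k p q then Num.sg (S k p q) else 0.
pose C := fix C k := if k is k'.+1
  then (fun j => if j == k' then rule (C k') k' else C k' j) else (fun _ _ _ => 0).
have CE k j : (j < k)%N -> C k j = C j.+1 j.
  elim: k => // k IH; rewrite ltnS leq_eqVlt => /predU1P[->//|jk].
  by rewrite /= (ltn_eqF jk) IH//= eqxx.
have CS k : C k.+1 k = rule (C k) k by rewrite /= eqxx.
pose c j := C j.+1 j; exists c => k p q.
rewrite {1}/c CS /rule /flat (@slope_prefix (C k) c) => [|j jk]; last by rewrite CE.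
rewrite (@slope_prefix (transpose (C k)) (transpose c))// => j jk.
by rewrite /transpose CE.
Qed.

End multiscale.

(** * Characteristic function of a difference of two samples *)

Section charfun.
Context {R : realType}.
Local Notation C := (complex.complex R).

(** The exponential exp(ix). *)
Definition cis (x : R) : C := complex.Complex (cos x) (sin x).

Lemma cisD x y : cis (x + y) = cis x * cis y.
Proof. by rewrite /cis cosD sinD addrC [in RHS]/GRing.mul/=; congr complex.Complex; ring. Qed.

Lemma cis0 : cis 0 = 1. Proof. by rewrite /cis cos0 sin0. Qed.

Lemma cis_sum (I : Type) (s : seq I) (x : I -> R) :
  cis (\sum_(i <- s) x i) = \prod_(i <- s) cis (x i).
Proof. by rewrite (big_morph cis cisD cis0). Qed.

Lemma Re_sum (I : Type) (s : seq I) (z : I -> C) :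
  complex.Re (\sum_(i <- s) z i) = \sum_(i <- s) complex.Re (z i).
Proof. by rewrite (big_morph (@complex.Re R) (id1 := 0) (op1 := +%R)) // => -[a b] [c d]. Qed.

Lemma Im_sum (I : Type) (s : seq I) (z : I -> C) :
  complex.Im (\sum_(i <- s) z i) = \sum_(i <- s) complex.Im (z i).
Proof. by rewrite (big_morph (@complex.Im R) (id1 := 0) (op1 := +%R)) // => -[a b] [c d]. Qed.

Lemma sum_cis (I : finType) (x : I -> R) :
  \sum_i cis (x i) = complex.Complex (\sum_i cos (x i)) (\sum_i sin (x i)).
Proof.
apply/eqP; rewrite complex.eq_complex/= Re_sum Im_sum.
by apply/andP; split; apply/eqP; apply: eq_bigr.
Qed.

(** Up to normalisation, both sides are the characteristic function of a sum of
independent differences: the product over the coordinates of a sum over the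
values is the sum over all configurations of the products. *)
Lemma sum_cos_ffun (G : finType) n (x : G -> R) :
  \sum_(a : {ffun 'I_n + 'I_n -> G})
    cos (\sum_(i < n) (x (a (inl i)) - x (a (inr i)))) =
  ((\sum_g cos (x g)) ^+ 2 + (\sum_g sin (x g)) ^+ 2) ^+ n.
Proof.
pose F (i : 'I_n + 'I_n) g : C := match i with inl _ => cis (x g) | inr _ => cis (- x g) end.
have prodF (a : {ffun 'I_n + 'I_n -> G}) :
    \prod_i F i (a i) = cis (\sum_(i < n) (x (a (inl i)) - x (a (inr i)))).
  by rewrite big_sumType/= sumrB -sumrN cisD !cis_sum.
have := congr1 (@complex.Re R) (bigA_distr_bigA F : \prod_i \sum_j F i j = 
   \sum_(f : {ffun 'I_n + 'I_n -> G}) \prod_i F i (f i)).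
rewrite Re_sum; under [RHS]eq_bigr do rewrite prodF /=.
move=> <-; rewrite big_sumType/= !prodr_const !card_ord -exprMn !sum_cis.
rewrite (eq_bigr (fun g => cos (x g)) (F1 := fun g => cos (- x g))); last by move=> g _; rewrite cosN.
rewrite (eq_bigr (fun g => - sin (x g)) (F1 := fun g => sin (- x g))); last by move=> g _; rewrite sinN.
rewrite sumrN.
set c := \sum_g cos (x g); set s := \sum_g sin (x g).
have -> : complex.Complex c s * complex.Complex c (- s) = (c ^+ 2 + s ^+ 2)%:C%C.
  by apply/eqP; rewrite complex.eq_complex/=; apply/andP; split; apply/eqP; ring.
by rewrite -rmorphXn.
Qed.

End charfun.

(** * Bounds on the cosine *)

Section trig.
Context {R : realType}.
Implicit Types x : R.

Lemma sin_mvt x : 0 < x -> exists2 y, 0 < y < x & sin x = x * cos y.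
Proof.
move=> x0; have [y] := @MVT R sin cos 0 x x0 (fun y _ => is_derive_sin y)
  (continuous_subspaceT (@continuous_sin R)).
by rewrite in_itv/= sin0 !subr0 mulrC => yx ->; exists y.
Qed.

Lemma one_sub_cosE x : 1 - cos x = 2 * sin (x / 2) ^+ 2.
Proof.
rewrite -{1}[x](_ : (x / 2) *+ 2 = _); last by rewrite -mulr_natr; field.
by rewrite cos_mulr2n sin2cos2; ring.
Qed.

Lemma one_sub_cos_ge0 x : 0 <= 1 - cos x.
Proof. by rewrite subr_ge0 cos_le1. Qed.

Lemma one_sub_cos_le2 x : 1 - cos x <= 2.
Proof. by have := cos_geN1 x; lra. Qed.

Lemma one_sub_cos_le x : 1 - cos x <= `|x|.
Proof.
wlog x0 : x / 0 <= x => [wl|].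
  have [/wl//|/ltW] := leP 0 x; rewrite -oppr_ge0 => /wl.
  by rewrite cosN normrN.
rewrite ger0_norm//; move: x0; rewrite le_eqVlt => /predU1P[<-|x0].
  by rewrite cos0 subrr.
have [|y _ yE] := @sin_mvt (x / 2); first by rewrite divr_gt0.
rewrite one_sub_cosE expr2 {1}yE.
have h1 : `|cos y * sin (x / 2)| <= 1.
  by rewrite normrM -[leRHS]mulr1; apply: ler_pM => //; [exact: cos_max|exact: sin_max].
have h2 := le_trans (ler_norm _) h1.
have -> : 2 * (x / 2 * cos y * sin (x / 2)) = x * (cos y * sin (x / 2)) by field.
by rewrite -[leRHS]mulr1 ler_wpM2l// ltW.
Qed.

Lemma one_sub_cos_ge x : `|x| <= 1 -> cos 1 ^+ 2 / 2 * x ^+ 2 <= 1 - cos x.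
Proof.
wlog x0 : x / 0 <= x => [wl|].
  have [/wl//|/ltW] := leP 0 x; rewrite -oppr_ge0 -normrN => /wl/[apply].
  by rewrite cosN sqrrN.
rewrite ger0_norm//; move: x0; rewrite le_eqVlt => /predU1P[<- _|x0 x1].
  by rewrite expr0n/= mulr0 one_sub_cos_ge0.
have [|y /andP[y0 yx] yE] := @sin_mvt (x / 2); first by rewrite divr_gt0.
rewrite one_sub_cosE yE.
have c1 := @cos1_gt0 R.
have cy : cos 1 <= cos y :> R.
  have pi2 := @pi_ge2 R.
  by rewrite ltW// ltr_cos ?in_itv/=; [lra|apply/andP; split; lra|apply/andP; split; lra].
have : cos 1 ^+ 2 <= cos y ^+ 2 by rewrite lerXn2r// nnegrE; lra.
rewrite exprMn; have := sqr_ge0 x => x2 c2.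
have -> : 2 * ((x / 2) ^+ 2 * cos y ^+ 2) = cos y ^+ 2 / 2 * x ^+ 2 by field.
by rewrite ler_wpM2r// ler_wpM2r// invr_ge0.
Qed.
End trig.

(** * Deviation of the discrepancy of one bump *)

Section deviation.
Context {R : realType}.

Lemma bernoulli_inv (z : R) n : 0 <= z <= 1 -> z ^+ n * (1 + n%:R * (1 - z)) <= 1.
Proof.
move=> /andP[z0 z1]; elim: n => [|n IH]; first by rewrite expr0 mul0r addr0 mulr1.
have zn : z ^+ n.+1 <= 1 by rewrite exprn_ile1.
rewrite -addn1 natrD.
have -> : z ^+ (n + 1) * (1 + (n%:R + 1%:R) * (1 - z)) =
  z * (z ^+ n * (1 + n%:R * (1 - z))) + z ^+ n.+1 * (1 - z).
  by rewrite addn1 exprS; ring.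
have h1 : z * (z ^+ n * (1 + n%:R * (1 - z))) <= z * 1 by rewrite ler_wpM2l.
have h2 : z ^+ n.+1 * (1 - z) <= 1 * (1 - z) by rewrite ler_wpM2r// subr_ge0.
lra.
Qed.

(** If the mean of 1 - cos of one difference is at least delta / n, then the mean of
cos of the sum of n independent differences is at most (1 - delta/n)^n, hence at
most 1 / (1 + delta) by Bernoulli. *)
Lemma sum_one_sub_cos (G : finType) n (x : G -> R) delta : (0 < #|G|)%N -> 0 <= delta ->
  delta * #|G|%:R ^+ 2 <= n%:R * \sum_g \sum_g' (1 - cos (x g - x g')) ->
  delta / (1 + delta) * #|{ffun 'I_n + 'I_n -> G}|%:R <=
  \sum_(a : {ffun 'I_n + 'I_n -> G})
    (1 - cos (\sum_(i < n) (x (a (inl i)) - x (a (inr i))))).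
Proof.
move=> G0 d0 h; have K0 : 0 < #|G|%:R :> R by rewrite ltr0n.
set K : R := #|G|%:R in h K0.
(* z is the square modulus of the characteristic function of one point. *)
pose z := ((\sum_g cos (x g)) ^+ 2 + (\sum_g sin (x g)) ^+ 2) / K ^+ 2.
have sumE : \sum_g \sum_g' (1 - cos (x g - x g')) = K ^+ 2 * (1 - z).
  rewrite mulrBr mulr1 /z mulrC divfK ?gt_eqF ?exprn_gt0//.
  under eq_bigr do rewrite sumrB.
  rewrite sumrB/=; congr (_ - _).
    by rewrite !sumr_const -mulrnA -[LHS]mulr_natr natrM mul1r -expr2.
  rewrite !expr2 !mulr_suml -big_split/=; apply: eq_bigr => g _.
  by rewrite !mulr_sumr -big_split/=; apply: eq_bigr => g' _; rewrite cosB.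
have z0 : 0 <= z by rewrite divr_ge0 ?addr_ge0 ?sqr_ge0.
have z1 : z <= 1.
  have : 0 <= K ^+ 2 * (1 - z).
    by rewrite -sumE; apply: sumr_ge0 => g _; apply: sumr_ge0 => g' _; exact: one_sub_cos_ge0.
  by rewrite pmulr_rge0 ?exprn_gt0// subr_ge0.
have dz : delta <= n%:R * (1 - z).
  rewrite -(ler_pM2r (exprn_gt0 2 K0)); move: h; rewrite sumE => /le_trans; apply.
  by rewrite mulrCA mulrC.
have zn : z ^+ n <= (1 + delta)^-1.
  rewrite -[leRHS]mul1r ler_pdivlMr; last lra.
  have z01 : 0 <= z <= 1 by rewrite z0.
  apply: le_trans _ (bernoulli_inv n z01).
  by rewrite ler_wpM2l ?exprn_ge0// lerD2l.
rewrite sumrB sum_cos_ffun sumr_const/=.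
have -> : #|{ffun 'I_n + 'I_n -> G}|%:R = (K ^+ 2) ^+ n.
  by rewrite card_ffun card_sum !card_ord natrX addnn -exprM mul2n.
have -> : (\sum_g cos (x g)) ^+ 2 + (\sum_g sin (x g)) ^+ 2 = z * K ^+ 2.
  by rewrite /z divfK ?gt_eqF ?exprn_gt0.
rewrite [(z * _) ^+ n]exprMn -[X in _ <= X - _]mul1r -mulrBl.
apply: ler_wpM2r; first by rewrite !exprn_ge0// ltW.
have -> : delta / (1 + delta) = 1 - (1 + delta)^-1 by field; lra.
by rewrite lerD2l lerN2.
Qed.

Lemma sum_range (M a b : nat) : (a <= b <= M)%N ->
  \sum_(x < M) (a <= x < b)%N%:R = (b - a)%:R :> R.
Proof.
move=> /andP[ab bM].
rewrite -(big_mkord xpredT (fun x => (a <= x < b)%N%:R : R)).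
rewrite (@big_cat_nat _ _ _ a)//=; last exact: leq_trans bM.
rewrite (@big_cat_nat _ _ _ b a M)//=.
rewrite big1_seq; last by move=> x /=; rewrite mem_index_iota => /andP[_ xa]; rewrite leqNgt xa.
rewrite [X in _ + (_ + X)]big1_seq; last first.
  by move=> x /=; rewrite mem_index_iota => /andP[bx _]; rewrite ltnNge bx andbF.
rewrite add0r addr0 (eq_big_nat _ _ (F2 := fun=> 1)); last by move=> x ->.
by rewrite sumr_const_nat.
Qed.

(** The summand of bumps attached to the block (p, q). *)
Definition bump l (p q : nat) (x y : nat) : R :=
  ((x %/ l == p) && (y %/ l == q))%N%:R * (tent l x * (tent l y / l%:R)).

Lemma bump_bound l p q x y : (0 < l)%N -> 0 <= bump l p q x y <= l%:R / 4.
Proof.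
move=> l0; have lR : 0 < l%:R :> R by rewrite ltr0n.
have h := @tent_le R l x l0; have h' := @tent_le R l y l0.
have g := @tent_ratio_ge0 R l x; have g' := @tent_ratio_ge0 R l y.
have -> : bump l p q x y = ((x %/ l == p) && (y %/ l == q))%N%:R *
  (l%:R * (tent l x / l%:R * (tent l y / l%:R))).
  by rewrite /bump; field; rewrite gt_eqF.
case: ((x %/ l == p)%N && (y %/ l == q)%N); last by rewrite /= mul0r lexx divr_ge0// ltW.
have : tent l x / l%:R * (tent l y / l%:R) <= 2^-1 * 2^-1 := ler_pM g g' h h'.
have := mulr_ge0 g g'; set t := _ * _ => t0 t1.
by rewrite /= mul1r; apply/andP; split; nra.
Qed.

Lemma bump_far l p q x y : (x %/ l)%N != p -> bump l p q x y = 0.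
Proof. by rewrite /bump => /negPf ->; rewrite mul0r. Qed.

(** On the central half of a block of side 4 l both tents are at least l. *)
Lemma bump_center l p q x y : (0 < l)%N ->
  (p * (4 * l) + l <= x < p * (4 * l) + 3 * l)%N ->
  (q * (4 * l) + l <= y < q * (4 * l) + 3 * l)%N ->
  l%:R / 4 <= bump (4 * l) p q x y.
Proof.
move=> l0.
have key p' x' : (p' * (4 * l) + l <= x' < p' * (4 * l) + 3 * l)%N ->
  (x' %/ (4 * l) = p')%N /\ l%:R <= tent (4 * l) x' :> R.
  move=> h; have e : x' = (p' * (4 * l) + (x' - p' * (4 * l)))%N by lia.
  split; first by rewrite e divnMDl ?divn_small; lia.
  by rewrite /tent e modnMDl modn_small ?ler_nat; lia.
move=> /key[xp tx] /key[yq ty]; rewrite /bump xp yq !eqxx/= mul1r.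
have lR : 0 < l%:R :> R by rewrite ltr0n.
rewrite mulrA ler_pdivlMr; last by rewrite ltr0n; lia.
have -> : l%:R / 4 * (4 * l)%:R = l%:R * l%:R :> R by rewrite natrM; field.
by apply: ler_pM.
Qed.

(** The factor 2^-12 collects the proportions of the cells used in bump_deviation: a
quarter of the block for the first point, at least one half of the columns for
the second one, the lower bound of the bump at the centre of the block, and the
factor 1/2 of one_sub_cos_ge. *)
Definition spread_const : R := cos 1 ^+ 2 / 2 ^+ 12.

Lemma spread_const_gt0 : 0 < spread_const.
Proof. by rewrite divr_gt0 ?exprn_gt0 ?cos1_gt0. Qed.

(** The frequency t is the inverse of the standard deviation of the discrepancy of a
bump, up to a constant. One point falls in the centre of the block with
probability of order s^-2 and the other one misses the block with probability at
least one half; the two values of t times the bump then differ by at least a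
constant times s / sqrt n. The condition s^2 <= 4n keeps this difference in the
range where 1 - cos is quadratic. *)
Lemma bump_deviation n s l p q (M := (s * (4 * l))%N) (G := ('I_M * 'I_M)%type)
    (t : R := s%:R ^+ 2 / (M%:R * Num.sqrt n%:R)) : (0 < n)%N -> (0 < l)%N -> (2 <= s)%N ->
  (s ^ 2 <= 4 * n)%N -> (p < s)%N -> (q < s)%N ->
  spread_const / (1 + spread_const) * #|{ffun 'I_n + 'I_n -> G}|%:R <=
  \sum_(a : {ffun 'I_n + 'I_n -> G})
    (1 - cos (\sum_(i < n) (t * bump (4 * l) p q (a (inl i)).1 (a (inl i)).2
                          - t * bump (4 * l) p q (a (inr i)).1 (a (inr i)).2))).
Proof.
move=> n0 l0 s2 sn ps qs.
have l40 : (0 < 4 * l)%N by lia.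
have M0 : (0 < M)%N by rewrite muln_gt0; lia.
have nR : 0 < n%:R :> R by rewrite ltr0n.
have MR : 0 < M%:R :> R by rewrite ltr0n.
have sR : 0 < s%:R :> R by rewrite ltr0n; lia.
have lR : 0 < l%:R :> R by rewrite ltr0n.
have r0 : 0 < Num.sqrt n%:R :> R by rewrite sqrtr_gt0.
have r2 : Num.sqrt n%:R ^+ 2 = n%:R :> R by rewrite sqr_sqrtr// ltW.
set r := Num.sqrt n%:R in r0 r2.
have ME : M%:R = s%:R * (4 * l%:R) :> R by rewrite /M !natrM.
have tE : t = s%:R / (4 * l%:R * r).
  by rewrite /t -/r ME; field; rewrite !gt_eqF.
have sr : s%:R <= 2 * r.
  rewrite -[leLHS]gtr0_norm// -[leRHS]gtr0_norm ?mulr_gt0// -ler_sqr ?nnegrE ?normr_ge0//.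
  rewrite !real_normK ?num_real// exprMn r2.
  by rewrite -!natrX -natrM ler_nat.
have t0 : 0 < t by rewrite tE divr_gt0 ?mulr_gt0.
pose f (g : G) := t * bump (4 * l) p q g.1 g.2.
apply: (@sum_one_sub_cos G n f); first by rewrite card_prod card_ord muln_gt0 M0.
  exact: ltW spread_const_gt0.
rewrite card_prod card_ord.
(* al and be are the indicators of the central half of the block p, and of the complement
   of the block p, on one axis. *)
pose al (p : nat) (x : 'I_M) : R := (p * (4 * l) + l <= x < p * (4 * l) + 3 * l)%N%:R.
pose be (x : 'I_M) : R := 1 - (p * (4 * l) <= x < p.+1 * (4 * l))%N%:R.
pose kap : R := cos 1 ^+ 2 / 2 * (t * (l%:R / 4)) ^+ 2.
have kap0 : 0 <= kap by rewrite /kap mulr_ge0 ?sqr_ge0// divr_ge0// sqr_ge0.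
have low (g g' : G) : al p g.1 * al q g.2 * be g'.1 * kap <= 1 - cos (f g - f g').
  rewrite /al; have [hx|_] := boolP (p * (4 * l) + l <= g.1 < p * (4 * l) + 3 * l)%N;
    last by rewrite /= !mul0r one_sub_cos_ge0.
  have [hy|_] := boolP (q * (4 * l) + l <= g.2 < q * (4 * l) + 3 * l)%N;
    last by rewrite /= mulr0 !mul0r one_sub_cos_ge0.
  rewrite /be; have [_|hb] := boolP (p * (4 * l) <= g'.1 < p.+1 * (4 * l))%N.
    by rewrite subrr mulr0 mul0r one_sub_cos_ge0.
  rewrite subr0 !mul1r.
  rewrite {2}/f bump_far; last first.
    by apply: contraNN hb => /eqP <-; rewrite leq_trunc_div//= -ltn_divLR.
  rewrite mulr0 subr0.
  have ctr := bump_center l0 hx hy.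
  have /andP[b0 b1] := @bump_bound (4 * l) p q g.1 g.2 l40.
  apply: le_trans (one_sub_cos_ge _).
    rewrite /kap /f ler_wpM2l//; first by rewrite divr_ge0// sqr_ge0.
    rewrite ler_sqr ?nnegrE ?mulr_ge0 ?divr_ge0 ?(ltW t0) ?(ltW lR)//.
    by rewrite ler_wpM2l// ltW.
  rewrite /f ger0_norm; last by rewrite mulr_ge0// ltW.
  apply: le_trans (ler_wpM2l (ltW t0) b1) _.
  have -> : t * ((4 * l)%:R / 4) = s%:R / (4 * r).
    by rewrite tE natrM; field; rewrite !gt_eqF.
  rewrite ler_pdivrMr ?mulr_gt0//; lra.
have al_sum p' : (p' < s)%N -> \sum_x al p' x = 2 * l%:R.
  move=> p's; rewrite /al sum_range; last by rewrite /M; apply/andP; split; nia.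
  by rewrite -natrM; congr _%:R; lia.
have be_sum : M%:R / 2 <= \sum_x be x.
  rewrite sumrB sumr_const card_ord sum_range; last by rewrite /M; apply/andP; split; nia.
  rewrite -mulnBl subSnn mul1n natrM ME.
  have : 2 <= s%:R :> R by rewrite ler_nat.
  move=> s2'; nra.
have : (2 * l%:R) * (2 * l%:R) * (M%:R / 2 * M%:R) * kap <=
  \sum_g \sum_g' (1 - cos (f g - f g')).
  apply: (@le_trans _ _ (\sum_(g : G) \sum_(g' : G) al p g.1 * al q g.2 * be g'.1 * kap)); last first.
    by apply: ler_sum => g _; apply: ler_sum => g' _.
  have -> : \sum_(g : G) \sum_(g' : G) al p g.1 * al q g.2 * be g'.1 * kap =
     (\sum_(g : G) al p g.1 * al q g.2) * (\sum_(g' : G) be g'.1) * kap.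
    rewrite !mulr_suml; apply: eq_bigr => g _.
    by rewrite mulr_sumr mulr_suml.
  rewrite ler_wpM2r//.
  rewrite -(pair_bigA _ (fun x y => al p x * al q y))/= -big_distrlr/= !al_sum//.
  rewrite -(pair_bigA _ (fun x _ => be x))/=.
  under [in leRHS]eq_bigr do rewrite sumr_const card_ord.
  rewrite sumrMnl -[(\sum_x be x) *+ M]mulr_natr.
  apply: ler_wpM2l; first by rewrite !mulr_ge0.
  by apply: ler_wpM2r.
move=> /(ler_wpM2l (ltW nR)); apply: le_trans.
rewrite le_eqVlt; apply/orP; left; apply/eqP.
rewrite /spread_const /kap tE -r2 natrM ME; field; rewrite !gt_eqF//.
Qed.
End deviation.

(** * The random test function on the grid *)

Section grid.
Context {R : realType}.

Lemma sum_pick (B j : nat) (F : nat -> R) : (j < B)%N ->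
  \sum_(0 <= p < B) (j == p)%N%:R * F p = F j.
Proof.
move=> jB; rewrite (bigD1_seq j) ?mem_index_iota ?iota_uniq//= eqxx mul1r big1 ?addr0// => p pj.
by rewrite eq_sym (negPf pj) mul0r.
Qed.

(** The lower bound of bump_deviation for the mean of 1 - cos. *)
Definition wave_const : R := spread_const / (1 + spread_const).

Lemma wave_const_gt0 : 0 < wave_const.
Proof. by have := @spread_const_gt0 R => d0; rewrite divr_gt0//; lra. Qed.

Variables (N r n : nat).

(** With r extra scales below the finest scale in use, the cells of the grid can be
made as small as desired. *)
Definition mesh k := (2 ^ (N + r - k))%N.
Definition side k := (2 ^ k.+1)%N.
Definition grid_size := (2 ^ (N + r).+1)%N.
Local Notation G := ('I_grid_size * 'I_grid_size)%type.
Local Notation sample := {ffun 'I_n + 'I_n -> G}.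

Lemma meshS k : (k < N)%N -> mesh k = (mesh k.+1).*2.
Proof. by move=> kN; rewrite /mesh -mul2n -expnS; congr expn; lia. Qed.

Lemma mesh_gt0 k : (0 < mesh k)%N. Proof. by rewrite expn_gt0. Qed.

Lemma side_mesh k : (k <= N)%N -> (side k * mesh k = grid_size)%N.
Proof. by move=> kN; rewrite /side /mesh -expnD; congr expn; lia. Qed.

Lemma grid_size_gt0 : (0 < grid_size)%N. Proof. by rewrite expn_gt0. Qed.

(** Without the factor 1/n, the difference of the integrals of f against the two
empirical measures, when the points are replaced by their cells. *)
Definition disc (f : nat -> nat -> R) (a : sample) : R :=
  \sum_(i < n) (f (a (inl i)).1 (a (inl i)).2 - f (a (inr i)).1 (a (inr i)).2).

Lemma bumps_pick c x y : (x < grid_size)%N -> (y < grid_size)%N ->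
  bumps mesh c N x y = \sum_(k < N) \sum_(0 <= p < side k) \sum_(0 <= q < side k)
    c k p q * bump (mesh k) p q x y :> R.
Proof.
move=> xM yM; apply: eq_bigr => k _.
have sm := side_mesh (ltnW (ltn_ord k)).
have lt z : (z < grid_size)%N -> (z %/ mesh k < side k)%N by rewrite ltn_divLR ?mesh_gt0// sm.
set u := (x %/ _)%N; set v := (y %/ _)%N; set T := (X in _ * X = _).
transitivity (\sum_(0 <= p < side k) (u == p)%N%:R *
   \sum_(0 <= q < side k) (v == q)%N%:R * (c k p q * T)).
  rewrite (sum_pick (fun p => \sum_(0 <= q < side k) (v == q)%N%:R * (c k p q * T)) (lt x xM)).
  by rewrite (sum_pick (fun q => c k u q * T) (lt y yM)).
apply: eq_bigr => p _; rewrite mulr_sumr; apply: eq_bigr => q _.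
by rewrite /bump -/u -/v -/T -mulnb natrM; ring.
Qed.

Lemma disc_bumps c a : disc (bumps mesh c N) a =
  \sum_(k < N) \sum_(0 <= p < side k) \sum_(0 <= q < side k)
    c k p q * disc (bump (mesh k) p q) a.
Proof.
rewrite /disc; under eq_bigr do rewrite !bumps_pick ?ltn_ord// -sumrB.
rewrite exchange_big; apply: eq_bigr => k _ /=.
under eq_bigr do rewrite -sumrB.
rewrite exchange_big; apply: eq_bigr => p _ /=.
under eq_bigr do rewrite -sumrB.
rewrite exchange_big; apply: eq_bigr => q _ /=.
by rewrite mulr_sumr; apply: eq_bigr => i _; rewrite mulrBr.
Qed.

(** The frequency of bump_deviation for the blocks of scale k. *)
Definition freq k : R := (side k)%:R ^+ 2 / (grid_size%:R * Num.sqrt n%:R).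

Hypothesis n0 : (0 < n)%N.

Lemma rootn_gt0 : 0 < Num.sqrt n%:R :> R.
Proof. by rewrite sqrtr_gt0 ltr0n. Qed.

Lemma grid_size_gt0R : 0 < grid_size%:R :> R. Proof. by rewrite ltr0n grid_size_gt0. Qed.

Lemma side_gt0R k : 0 < (side k)%:R :> R. Proof. by rewrite ltr0n expn_gt0. Qed.

Lemma freq_gt0 k : 0 < freq k.
Proof. by rewrite divr_gt0 ?exprn_gt0 ?side_gt0R// mulr_gt0 ?grid_size_gt0R ?rootn_gt0. Qed.

(** There are (side k)^2 blocks of scale k, each contributing about 1 / freq k, so
every scale contributes the same amount. *)
Lemma side_freq k : (side k)%:R ^+ 2 / freq k = grid_size%:R * Num.sqrt n%:R.
Proof.
by rewrite /freq; field; rewrite !gt_eqF ?rootn_gt0 ?grid_size_gt0R ?side_gt0R.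
Qed.

(** A bounded substitute for the absolute value of the discrepancy: it is smaller by
wave_le, its mean is of the right order by sum_wave, and being at most 2 / freq k
it makes the loss caused by the stopped blocks proportional to their number. *)
Definition wave k p q (a : sample) : R :=
  (1 - cos (freq k * disc (bump (mesh k) p q) a)) / freq k.

Lemma wave_le2 k p q a : wave k p q a <= 2 / freq k.
Proof. by rewrite ler_pM2r ?invr_gt0 ?freq_gt0// one_sub_cos_le2. Qed.

Lemma wave_le k p q a : wave k p q a <= `|disc (bump (mesh k) p q) a|.
Proof.
have f0 := freq_gt0 k; rewrite ler_pdivrMr//.
by apply: le_trans (one_sub_cos_le _) _; rewrite normrM gtr0_norm// mulrC.
Qed.

Hypotheses (r0 : (0 < r)%N) (Nn : (4 ^ N.-1 <= n)%N).

Lemma sum_wave k p q : (k < N)%N -> (p < side k)%N -> (q < side k)%N ->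
  wave_const / freq k * #|[the finType of sample]|%:R <= \sum_a wave k p q a.
Proof.
move=> kN ps qs.
have mE : mesh k = (4 * 2 ^ (N + r - k - 2))%N.
  by rewrite -(expnD 2 2); congr expn; lia.
have s2 : (2 <= side k)%N by rewrite /side expnS leq_pmulr// expn_gt0.
have sn : (side k ^ 2 <= 4 * n)%N.
  rewrite /side -expnM mulSn expnD leq_mul2l/=.
  rewrite mulnC expnM; apply: leq_trans Nn; rewrite leq_pexp2l//; lia.
have e0 : (0 < 2 ^ (N + r - k - 2))%N by rewrite expn_gt0.
have := @bump_deviation R n (side k) _ p q n0 e0 s2 sn ps qs.
rewrite -mE side_mesh ?(ltnW kN)//= => h.
rewrite -mulr_suml mulrAC ler_pM2r ?invr_gt0 ?freq_gt0//.
apply: le_trans h _; apply: ler_sum => a _.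
rewrite /disc mulr_sumr le_eqVlt; apply/orP; left; apply/eqP.
by congr (1 - cos _); apply: eq_bigr => i _; rewrite mulrBr.
Qed.

(** The coefficients are the signs of the discrepancies, set to 0 on the blocks that
are too steep; the subtracted term bounds the contribution of those blocks, whose
number is controlled by count_steep in both directions for every sample. *)
Lemma stopped_disc lam a : 1 < lam -> exists c,
  [/\ (forall k p q, `|c k p q| <= 1 :> R),
      (forall k p q, c k p q != 0 -> flat mesh lam c k p q) &
      \sum_(k < N) (\sum_(0 <= p < side k) \sum_(0 <= q < side k) wave k p q a
         - grid_size%:R * Num.sqrt n%:R * (N%:R / (lam - 1) ^+ 2))
       <= disc (bumps mesh c N) a].
Proof.
move=> lam1.
have [c cE] := @stopped_signs R mesh lam (fun k p q => disc (bump (mesh k) p q) a).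
have c1 k p q : `|c k p q| <= 1.
  by rewrite cE; case: ifP => _; rewrite ?normr0// normr_sg; case: eqP.
exists c; split=> //.
  by move=> k p q; rewrite cE; case: ifP => //; rewrite eqxx.
rewrite disc_bumps; apply: ler_sum => k _.
have kN := ltnW (ltn_ord k).
have f0 := freq_gt0 k.
(* st is 1 on the blocks that are too steep in the horizontal direction; its transpose
   takes care of the vertical one. *)
pose st c (p q : nat) : R := (lam < `|slope mesh c k (p * mesh k) (q * mesh k)|)%R%:R.
have low p q : wave k p q a - 2 / freq k * (st c p q + st (transpose c) q p) <=
    c k p q * disc (bump (mesh k) p q) a.
  rewrite cE /st /flat !ltNge; case: (_ <= lam) => /=; last first.
    rewrite mul0r subr_le0 (le_trans (wave_le2 _ _ _ _))//.
    by rewrite ler_peMr ?divr_ge0 ?(ltW f0)// lerDl ler0n.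
  case: (_ <= lam) => /=; last first.
    rewrite mul0r subr_le0 (le_trans (wave_le2 _ _ _ _))//.
    by rewrite ler_peMr ?divr_ge0 ?(ltW f0)// lerDr ler0n.
  by rewrite addr0 mulr0 subr0 -normrEsg wave_le.
apply: (@le_trans _ _ (\sum_(0 <= p < side k) \sum_(0 <= q < side k)
   (wave k p q a - 2 / freq k * (st c p q + st (transpose c) q p)))); last first.
  by apply: ler_sum => p _; apply: ler_sum => q _.
under [leRHS]eq_bigr do rewrite sumrB.
rewrite [leRHS]sumrB lerD2l lerN2.
under eq_bigr do rewrite -mulr_sumr big_split/=.
rewrite -mulr_sumr big_split/= [X in _ + X]exchange_big/=.
have sm : (side k * mesh k = 2 * mesh 0)%N by rewrite side_mesh// /grid_size expnS /mesh subn0.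
have lam1' := ltW lam1.
have h1 := @count_steep R mesh N meshS (mesh_gt0 N) c c1 lam k _ _ kN sm lam1'.
have ct1 j p q : `|transpose c j p q| <= 1 by exact: c1.
have h2 := @count_steep R mesh N meshS (mesh_gt0 N) _ ct1 lam k _ _ kN sm lam1'.
rewrite -(side_freq k).
move: h1 h2; rewrite -/(st _ _ _).
set X := \sum_(_ <= _ < _) _; set Y := \sum_(_ <= _ < _) _ => h1 h2.
have l0 : 0 < (lam - 1) ^+ 2 by rewrite exprn_gt0// subr_gt0.
have kNR : k%:R <= N%:R :> R by rewrite ler_nat.
have XY : X + Y <= (side k)%:R ^+ 2 * N%:R / 2 / (lam - 1) ^+ 2.
  rewrite ler_pdivlMr// mulrDl; apply: le_trans (lerD h1 h2) _.
  have := ler_wpM2l (sqr_ge0 (side k)%:R) kNR; lra.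
have f20 : 0 <= 2 / freq k by rewrite divr_ge0// ltW.
apply: le_trans (ler_wpM2l f20 XY) _.
have lamn : lam - 1 != 0 by rewrite gt_eqF// subr_gt0.
by rewrite le_eqVlt; apply/orP; left; apply/eqP; field; rewrite lamn (gt_eqF f0).
Qed.

(** With this lam the steep blocks lose at most half of the mean of the waves. *)
Lemma sum_stopped_disc lam (c : sample -> nat -> nat -> nat -> R) : 
  (lam - 1) ^+ 2 = 2 * N%:R / wave_const -> 1 < lam ->
  (forall a, \sum_(k < N) (\sum_(0 <= p < side k) \sum_(0 <= q < side k) wave k p q a
         - grid_size%:R * Num.sqrt n%:R * (N%:R / (lam - 1) ^+ 2))
       <= disc (bumps mesh (c a) N) a) ->
  #|[the finType of sample]|%:R * (N%:R * (grid_size%:R * Num.sqrt n%:R) * wave_const / 2) <=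
  \sum_a disc (bumps mesh (c a) N) a.
Proof.
move=> lamE lam1 h; apply: le_trans (ler_sum _ (fun a _ => h a)).
rewrite exchange_big/=.
have -> : #|[the finType of sample]|%:R * (N%:R * (grid_size%:R * Num.sqrt n%:R) * wave_const / 2) =
  \sum_(k < N) (#|[the finType of sample]|%:R * ((grid_size%:R * Num.sqrt n%:R) * wave_const / 2)).
  by rewrite sumr_const card_ord -[RHS]mulr_natr; ring.
apply: ler_sum => k _.
have N0 : 0 < N%:R :> R by rewrite ltr0n; apply: leq_ltn_trans (ltn_ord k).
rewrite sumrB sumr_const -[grid_size%:R * Num.sqrt n%:R * (N%:R / (lam - 1) ^+ 2) *+ _]mulr_natr.
set K := #|_|%:R.
have -> : K * (grid_size%:R * Num.sqrt n%:R * wave_const / 2) = grid_size%:R * Num.sqrt n%:R * wave_const * K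
    - grid_size%:R * Num.sqrt n%:R * (N%:R / (lam - 1) ^+ 2) * K.
  by rewrite lamE; field; rewrite !gt_eqF// wave_const_gt0.
rewrite lerD2r exchange_big/=.
apply: (@le_trans _ _ (\sum_(0 <= p < side k) \sum_(0 <= q < side k) wave_const / freq k * K)).
  rewrite !sumr_const_nat !subn0 -mulrnA -[leRHS]mulr_natr natrM -(side_freq k).
  by rewrite le_eqVlt; apply/orP; left; apply/eqP; field; rewrite !gt_eqF// freq_gt0.
apply: ler_sum_nat => p /andP[_ ps].
rewrite exchange_big/=; apply: ler_sum_nat => q /andP[_ qs].
exact: sum_wave.
Qed.

End grid.

(** * Integrals and measures bounded through finite partitions *)

Section measure_tools.
Context d (T : measurableType d) (R : realType) (mu : {measure set T -> \bar R}).
Local Open Scope ereal_scope.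

(** The integral of a nonnegative function is a supremum over the simple functions
below it, hence monotone for arbitrary functions. The transport cost, as a function
of the sample, is bounded below in this way. *)
Lemma le_integral_nonneg (D : set T) (f g : T -> \bar R) :
  (forall x, D x -> 0 <= f x) -> (forall x, D x -> f x <= g x) ->
  \int[mu]_(x in D) f x <= \int[mu]_(x in D) g x.
Proof.
move=> f0 fg; rewrite !ge0_integralE//; last by move=> x Dx; exact: le_trans (f0 x Dx) (fg x Dx).
apply: ge_ereal_sup => _ [h hf <-]; apply: ereal_sup_ubound; exists h => // x.
apply: le_trans (hf x) _; rewrite /patch; case: ifP => //; rewrite inE; exact: fg.
Qed.

Lemma measure_partition (I : finType) (B : I -> set T) (C : set T) :
  measurable C -> (forall i, measurable (B i)) -> trivIset setT B ->
  mu (C `\` \bigcup_i B i) = 0 -> mu C = \sum_i mu (C `&` B i).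
Proof.
move=> mC mB tB C0.
have mE s : measurable (\big[setU/set0]_(i <- s) (C `&` B i)).
  by elim/big_ind : _ => // [A A' mA mA'|i _]; [exact: measurableU|exact: measurableI].
have key s : uniq s -> mu (\big[setU/set0]_(i <- s) (C `&` B i)) =
    \sum_(i <- s) mu (C `&` B i).
  elim: s => [|j s IH] /=; first by rewrite !big_nil measure0.
  move=> /andP[js us]; rewrite !big_cons measureU; [by congr (_ + _); exact: IH|exact: measurableI|exact: mE|].
  rewrite -subset0 => x [[_ Bj]]; rewrite -bigcup_seq => -[i /= si [_ Bi]].
  have ij : i = j by apply: tB => //; exists x.
  by move: js; rewrite -ij si.
rewrite -key ?index_enum_uniq//.
rewrite (measureDI mu mC (mE (index_enum I))) (setIidr (B := \big[_/_]_(_ <- _) _)); last first.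
  by rewrite -bigcup_seq => x [i _ []].
rewrite [X in X + _](_ : _ = 0) ?add0e//.
rewrite -C0; congr (mu _); rewrite -bigcup_seq; apply/seteqP; split => x [Cx nx]; split => //.
  by apply: contra_not nx => -[i _ Bi]; exists i => //=; exact: mem_index_enum.
by apply: contra_not nx => -[i _ [_ Bi]]; exists i.
Qed.

Lemma sum_le_integral (D : set T) (I : finType) (A : I -> set T) (v : I -> R) (f : T -> R) :
  measurable D -> (forall i, measurable (A i)) -> trivIset setT A ->
  (forall i, A i `<=` D) -> (forall i, 0 <= v i)%R ->
  (forall x, D x -> 0 <= f x)%R -> (forall i x, A i x -> v i <= f x)%R ->
  \sum_i (v i)%:E * mu (A i) <= \int[mu]_(x in D) (f x)%:E.
Proof.
move=> mD mA tA AD v0 f0 vf.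
have -> : \sum_i (v i)%:E * mu (A i) =
    \int[mu]_(x in D) \sum_(i <- index_enum I) ((v i)%:E * (\1_(A i) x)%:E).
  rewrite ge0_integral_sum//.
  - apply: eq_bigr => i _; rewrite ge0_integralZl_EFin//.
    + by rewrite integral_indic// setIidl.
    + by apply/measurable_EFinP; apply: measurable_funTS; exact: measurable_indic.
  - by move=> i; apply: measurable_funeM; apply/measurable_EFinP; apply: measurable_funTS; exact: measurable_indic.
  - by move=> i x _; rewrite mule_ge0// lee_fin.
apply: le_integral_nonneg => x Dx.
  by apply: sume_ge0 => i _; rewrite mule_ge0// lee_fin.
have [[i Ai]|nA] := pselect (exists i, A i x); last first.
  rewrite big1 ?lee_fin ?f0// => i _; rewrite indicE memNset ?mule0// => Ai.
  by apply: nA; exists i.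
rewrite (bigD1 i)//= big1 ?adde0 => [|j ji].
  by rewrite indicE mem_set// mule1 lee_fin vf.
rewrite indicE memNset ?mule0// => Aj; move/eqP: ji; apply.
by apply: tA => //; exists x.
Qed.

End measure_tools.

(** * Cells of the torus *)

Section cells.
Context {R : realType}.

Section lipschitz.
Variables (g : nat -> R) (L : R).
Hypothesis gL : forall x, `|g x.+1 - g x| <= L.

Lemma step_lipschitz x x' : `|g x - g x'| <= L * `|x%:R - x'%:R|.
Proof.
wlog xx : x x' / (x <= x')%N => [wl|].
  have [/wl//|/ltnW/wl] := leqP x x'.
  by rewrite distrC (distrC x'%:R).
rewrite -(subnK xx); elim: (x' - x)%N => [|k IH].
  by rewrite add0n !subrr normr0 mulr0.
have -> : g x - g (k.+1 + x)%N = (g x - g (k + x)%N) - (g (k + x).+1 - g (k + x)%N).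
  by rewrite addSn; ring.
apply: le_trans (ler_normB _ _) _; apply: le_trans (lerD IH (gL _)) _.
have nE m : `|x%:R - (m + x)%:R| = m%:R :> R.
  by rewrite natrD opprD addrCA subrr addr0 normrN normr_nat.
by rewrite !nE -addn1 natrD mulrDr mulr1.
Qed.

(** Going the other way round the circle passes through the multiples of M, where g
vanishes. *)
Lemma circle_lipschitz M x x' : g 0%N = 0 -> g M = 0 -> (x <= M)%N -> (x' <= M)%N ->
  `|g x - g x'| <= L * Num.min `|x%:R - x'%:R| (M%:R - `|x%:R - x'%:R|).
Proof.
move=> g0 gM; wlog xx : x x' / (x <= x')%N => [wl xM x'M|].
  have [xx|/ltnW xx] := leqP x x'; first exact: wl.
  by rewrite distrC (distrC x%:R); exact: wl.
move=> xM x'M; rewrite minEle; case: ifP => _; first exact: step_lipschitz.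
have h1 := step_lipschitz 0 x; have h2 := step_lipschitz x' M.
rewrite g0 sub0r normrN sub0r normrN normr_nat in h1.
rewrite gM subr0 distrC -natrB// normr_nat natrB// in h2.
rewrite (distrC x%:R) -natrB// normr_nat natrB//.
apply: le_trans (ler_normB _ _) _; apply: le_trans (lerD h1 h2) _.
by rewrite -mulrDr le_eqVlt; apply/orP; left; apply/eqP; ring.
Qed.

End lipschitz.

Variable M : nat.
Hypothesis M0 : (0 < M)%N.

Definition width : R := 2 * pi / M%:R.

Lemma M_gt0R : 0 < M%:R :> R. Proof. by rewrite ltr0n. Qed.

Lemma width_gt0 : 0 < width.
Proof. by rewrite divr_gt0 ?M_gt0R// mulr_gt0// pi_gt0. Qed.

Lemma M_width : M%:R * width = 2 * pi.
Proof. by rewrite /width mulrC divfK// gt_eqF ?M_gt0R. Qed.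

(** The arcs are open on the left, as the fundamental domain of the torus is. *)
Definition arc (i : nat) : set R := `]- pi + i%:R * width, - pi + i.+1%:R * width].

Definition cell (g : 'I_M * 'I_M) : set (R * R) := arc g.1 `*` arc g.2.

Lemma arcP i u : arc i u -> i%:R * width < u + pi <= i.+1%:R * width.
Proof. by rewrite /arc/= in_itv/= => /andP[? ?]; apply/andP; split; lra. Qed.

Lemma arc_cover u : - pi < u <= pi -> exists i : 'I_M, arc i u.
Proof.
move=> /andP[u1 u2].
have : forall m, u <= - pi + m%:R * width -> exists2 i, (i < m)%N & arc i u.
  elim=> [|m IH]; first by rewrite mul0r addr0 leNgt u1.
  move=> um; have [/IH[i im iu]|mu] := leP u (- pi + m%:R * width).
    by exists i => //; exact: ltnW.
  by exists m => //; rewrite /arc/= in_itv/= mu.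
move=> /(_ M); rewrite M_width; case; first lra.
by move=> i iM iu; exists (Ordinal iM).
Qed.

Lemma arc_inj i j u : arc i u -> arc j u -> i = j.
Proof.
have w0 := width_gt0.
wlog ij : i j / (i < j)%N => [wl iu ju|].
  by case: (ltngtP i j) => // ij; [exact: wl|apply/esym; exact: wl].
move=> /arcP/andP[_ h1] /arcP/andP[h2 _].
by have := lt_le_trans h2 h1; rewrite ltr_pM2r// ltr_nat ltnS leqNgt ij.
Qed.

Lemma arc_sub i u : (i < M)%N -> arc i u -> - pi < u <= pi.
Proof.
have w0 := width_gt0.
move=> iM /arcP/andP[h1 h2]; have : 0 <= i%:R * width by rewrite mulr_ge0// ltW.
have : i.+1%:R * width <= M%:R * width by rewrite ler_pM2r// ler_nat.
rewrite M_width => ? ?; apply/andP; split; lra.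
Qed.

Lemma cell_cover z : Q2 z -> exists g, cell g z.
Proof.
case: z => u v [/=]; rewrite !in_itv/= => /arc_cover[i iu] /arc_cover[j jv].
by exists (i, j).
Qed.

Lemma cell_sub g : cell g `<=` Q2.
Proof. by move=> z [/arc_sub h1 /arc_sub h2]; split; rewrite /= in_itv/=; [exact: h1|exact: h2]. Qed.

Lemma cell_inj g g' z : cell g z -> cell g' z -> g = g'.
Proof.
case: g g' => i j [i' j'] [/= h1 h2] [/= h3 h4].
by congr pair; apply: val_inj; [exact: arc_inj h1 h3|exact: arc_inj h2 h4].
Qed.

Lemma measurable_cell g : measurable (cell g).
Proof. by apply: measurableX; exact: measurable_itv. Qed.

Lemma measurable_Q2 : measurable (@Q2 R).
Proof. by apply: measurableX; exact: measurable_itv. Qed.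

Lemma lebesgue_cell g :
  (lebesgue_measure \x lebesgue_measure)%E (cell g) = (width ^+ 2)%:E.
Proof.
have arcE i : lebesgue_measure (arc i) = width%:E :> \bar R.
  rewrite /arc lebesgue_measure_itv/= lte_fin ltrD2l ltr_pM2r ?width_gt0//.
  rewrite ltr_nat ltnSn -EFinB; congr EFin.
  by rewrite -addn1 natrD; ring.
have mA i : measurable (arc i) by exact: measurable_itv.
rewrite product_measure1E; [|exact: mA|exact: mA].
by rewrite expr2 EFinM; congr (_ * _)%E; exact: arcE.
Qed.

Lemma rho_ge0 u v : - pi < u <= pi -> - pi < v <= pi -> 0 <= rho u v :> R.
Proof.
move=> /andP[u1 u2] /andP[v1 v2]; rewrite /rho le_min normr_ge0/= subr_ge0.
by rewrite ler_norml; apply/andP; split; lra.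
Qed.

(** A point of an arc is within one arc length of its end, so distances between the
indices and between the points agree up to one arc length. *)
Lemma arc_rho i j u v : arc i u -> arc j v ->
  Num.min `|i%:R - j%:R| (M%:R - `|i%:R - j%:R|) * width <= rho u v + width.
Proof.
have w0 := width_gt0.
move=> /arcP/andP[u1 u2] /arcP/andP[v1 v2].
have h : `| `|i%:R - j%:R| * width - `|u - v| | <= width.
  have := ler_dist_dist ((i%:R - j%:R) * width) (u - v).
  rewrite normrM (gtr0_norm w0) => /le_trans; apply.
  rewrite mulrBl ler_norml; rewrite -[i.+1]addn1 natrD mulrDl mul1r in u2.
  rewrite -[j.+1]addn1 natrD mulrDl mul1r in v2.
  apply/andP; split; lra.
move: h; rewrite ler_norml => /andP[h1 h2].
rewrite /rho -lerBlDr le_min; apply/andP; split; rewrite lerBlDr.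
  apply: (@le_trans _ _ (`|i%:R - j%:R| * width)); last lra.
  by rewrite ler_pM2r// ge_min lexx.
apply: (@le_trans _ _ ((M%:R - `|i%:R - j%:R|) * width)).
  by rewrite ler_pM2r// ge_min lexx orbT.
by rewrite mulrBl M_width; lra.
Qed.

Lemma rho_le_rho2 (z z' : R * R) :
  rho z.1 z'.1 <= rho2 z z' /\ rho z.2 z'.2 <= rho2 z z'.
Proof.
have key (a b : R) : a <= Num.sqrt (a ^+ 2 + b ^+ 2).
  apply: le_trans (ler_norm _) _; rewrite -sqrtr_sqr ler_wsqrtr// lerDl.
  exact: sqr_ge0.
by split; rewrite /rho2; [|rewrite addrC]; exact: key.
Qed.

(** A Lipschitz function of the cells bounds the distance from below, with an error
equal to the width of a cell. *)
Lemma cell_lipschitz (f : nat -> nat -> R) (L : R) g g' z z' : 0 < L ->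
  (forall x y, `|f x.+1 y - f x y| <= L) -> (forall x y, `|f x y.+1 - f x y| <= L) ->
  (forall y, f 0%N y = 0) -> (forall y, f M y = 0) ->
  (forall x, f x 0%N = 0) -> (forall x, f x M = 0) ->
  cell g z -> cell g' z' ->
  width / (2 * L) * (f g.1 g.2 - f g'.1 g'.2) - width <= rho2 z z'.
Proof.
move=> L0 L1 L2 f01 fM1 f02 fM2 [z1 z2] [z1' z2'].
have w0 := width_gt0.
have := @circle_lipschitz (f^~ g.2) L (L1^~ g.2) M g.1 g'.1 (f01 _) (fM1 _)
  (ltnW (ltn_ord _)) (ltnW (ltn_ord _)).
have := @circle_lipschitz (f g'.1) L (L2 g'.1) M g.2 g'.2 (f02 _) (fM2 _)
  (ltnW (ltn_ord _)) (ltnW (ltn_ord _)).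
have := arc_rho z1 z1'; have := arc_rho z2 z2'.
have [] := rho_le_rho2 z z'.
set r1 := Num.min _ _; set r2 := Num.min _ _; set D := rho2 _ _.
set a := rho _ _; set b := rho _ _.
move=> aD bD r2b r1a /(le_trans (ler_norm _)) f2 /(le_trans (ler_norm _)) f1.
have : f g.1 g.2 - f g'.1 g'.2 <= L * (r1 + r2) by lra.
move=> /(ler_wpM2l (ltW w0)) h.
have h3 : width * (L * (r1 + r2)) <= L * (2 * (D + width)).
  have -> : width * (L * (r1 + r2)) = L * (r1 * width + r2 * width) by ring.
  by rewrite ler_pM2l//; lra.
rewrite lerBlDr mulrAC ler_pdivrMr ?mulr_gt0//.
apply: le_trans h _; apply: le_trans h3 _.
by rewrite le_eqVlt; apply/orP; left; apply/eqP; ring.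
Qed.

End cells.

(** * Cost of a coupling of two empirical measures *)

Section transport.
Context {R : realType}.
Variables (n M : nat).
Hypothesis M0 : (0 < M)%N.
Local Notation cells := ('I_M * 'I_M)%type.

Lemma empirical_setT (d : measure_display) (T : measurableType d) (x : 'I_n.+1 -> T) :
  empirical_measure R x [set: T] = 1%E.
Proof.
rewrite /empirical_measure; under eq_bigr do rewrite diracE in_setT.
by rewrite sumEFin sumr_const card_ord -EFinM mulVf// pnatr_eq0.
Qed.

HB.instance Definition _ (d : measure_display) (T : measurableType d) (x : 'I_n.+1 -> T) :=
  Measure_isProbability.Build d T R (empirical_measure R x) (empirical_setT x).

Variables (x y : 'I_n.+1 -> R * R) (a b : 'I_n.+1 -> cells).
Hypothesis xa : forall i, cell (R := R) (a i) (x i).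
Hypothesis yb : forall i, cell (R := R) (b i) (y i).

Lemma empirical_cell (z : 'I_n.+1 -> R * R) (c : 'I_n.+1 -> cells) g :
  (forall i, cell (c i) (z i)) ->
  empirical_measure R z (cell g) = (n.+1%:R^-1 * \sum_i (c i == g)%:R)%:E.
Proof.
move=> zc; rewrite /empirical_measure EFinM -sumEFin; congr (_ * _)%E.
apply: eq_bigr => i _; rewrite diracE; congr (_%:R%:E); congr nat_of_bool.
apply/idP/eqP => [|<-]; last by rewrite inE.
by rewrite inE => /(cell_inj M0 (zc i)).
Qed.

Lemma empirical_outside (z : 'I_n.+1 -> R * R) (c : 'I_n.+1 -> cells) :
  (forall i, cell (c i) (z i)) -> empirical_measure R z (~` Q2) = 0%E.
Proof.
move=> zc; rewrite /empirical_measure big1 ?mule0// => i _.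
by rewrite diracE memNset//= => /(_ (cell_sub M0 (zc i))).
Qed.

Lemma rho2_bound (z z' : R * R) : Q2 z -> Q2 z' ->
  0 <= rho2 z z' <= Num.sqrt ((2 * pi) ^+ 2 + (2 * pi) ^+ 2).
Proof.
move=> [z1 z2] [z1' z2']; rewrite /rho2 sqrtr_ge0/=.
have key (u v : R) : u \in `]- pi, pi] -> v \in `]- pi, pi] -> rho u v ^+ 2 <= (2 * pi) ^+ 2.
  rewrite !in_itv/= => hu hv; have := rho_ge0 hu hv => r0.
  rewrite lerXn2r ?nnegrE ?mulr_ge0 ?pi_ge0// /rho ge_min.
  move: hu hv => /andP[u1 u2] /andP[v1 v2].
  by rewrite ler_norml; apply/orP; left; apply/andP; split; lra.
by rewrite ler_wsqrtr// lerD// key.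
Qed.

(** A joint law whose second marginal is carried by the torus is determined on a
strip by the products of cells contained in it. *)
Lemma measure_marginal (d : measure_display) (T : measurableType d)
    (mu : {measure set T -> \bar R}) (p q : T -> R * R) (g : cells) :
  measurable_fun setT p -> measurable_fun setT q -> mu (q @^-1` (~` Q2)) = 0%E ->
  mu (p @^-1` cell g) = (\sum_(g' : cells) mu (p @^-1` cell g `&` q @^-1` cell g'))%E.
Proof.
move=> mp mq q0.
have mcell (r : T -> R * R) (g' : cells) : measurable_fun setT r -> measurable (r @^-1` cell g').
  by move=> mr; rewrite -[X in measurable X]setTI; apply: mr => //; exact: measurable_cell.
apply: measure_partition => [|g'||]; [exact: mcell|exact: mcell| |].
  by move=> g1 g2 _ _ [z [/= h1 h2]]; exact: (cell_inj M0 h1 h2).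
apply: (@subset_measure0 _ _ _ mu _ (q @^-1` (~` Q2))) => //.
- by apply: measurableD; [exact: mcell|apply: fin_bigcup_measurable => // g' _; exact: mcell].
- rewrite -[X in measurable X]setTI; apply: mq => //.
  by apply: measurableC; exact: measurable_Q2.
- by move=> z [_ nz] /= /(cell_cover M0)[g' zg']; apply: nz; exists g'.
Qed.

Section cost.
Variables (f : nat -> nat -> R) (L : R).
Hypothesis L0 : 0 < L.
Hypothesis L1 : forall p q, `|f p.+1 q - f p q| <= L.
Hypothesis L2 : forall p q, `|f p q.+1 - f p q| <= L.
Hypothesis f01 : forall y, f 0%N y = 0.
Hypothesis fM1 : forall y, f M y = 0.
Hypothesis f02 : forall x, f x 0%N = 0.
Hypothesis fM2 : forall x, f x M = 0.

(** Kantorovich duality, in its easy direction, for the function f of the cells: the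
cost is bounded below on each product of two cells by cell_lipschitz, and the sum
over the products of cells depends on the marginals only. *)
Lemma coupling_cost (lambda : probability ((R * R) * (R * R))%type R) :
  coupling (empirical_measure R x) (empirical_measure R y) lambda ->
  ((width M / (2 * L) / n.+1%:R *
     (\sum_i (f (a i).1 (a i).2 - f (b i).1 (b i).2)) - width M)%:E <=
  \int[lambda]_(z in Q2 `*` Q2) (rho2 z.1 z.2)%:E)%E.
Proof.
move=> [lx ly].
have mcell g : measurable (cell (R := R) (M := M) g) by exact: measurable_cell.
pose A (p : cells * cells) := cell (R := R) p.1 `*` cell (R := R) p.2.
have mA p : measurable (A p) by apply: measurableX.
pose F (g : cells) := f g.1 g.2.
pose w p := width M / (2 * L) * (F p.1 - F p.2) - width M.
pose v (p : cells * cells) := Num.max 0 (w p).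
have Alam p : lambda (A p) \is a fin_num by exact: fin_num_measure.
(* m is the joint law of the two cells under the coupling. *)
pose m p := fine (lambda (A p)).
have m0 p : 0 <= m p by rewrite fine_ge0.
have mfst : measurable_fun setT (fst : (R * R) * (R * R) -> R * R) by exact: measurable_fst.
have msnd : measurable_fun setT (snd : (R * R) * (R * R) -> R * R) by exact: measurable_snd.
have mQc : measurable (~` @Q2 R) by apply: measurableC; exact: measurable_Q2.
have rows g : \sum_g' m (g, g') = n.+1%:R^-1 * \sum_i (a i == g)%:R.
  apply/EFin_inj; rewrite -(empirical_cell g xa) -lx// -sumEFin.
  rewrite [RHS](measure_marginal g mfst msnd).
    by apply: eq_bigr => g' _; rewrite fineK.
  by rewrite -(empirical_outside yb) -ly.
have cols g : \sum_g' m (g', g) = n.+1%:R^-1 * \sum_i (b i == g)%:R.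
  apply/EFin_inj; rewrite -(empirical_cell g yb) -ly// -sumEFin.
  rewrite [RHS](measure_marginal g msnd mfst).
    by apply: eq_bigr => g' _; rewrite fineK// setIC.
  by rewrite -(empirical_outside xa) -lx.
have avg (c : 'I_n.+1 -> cells) :
    \sum_g F g * (n.+1%:R^-1 * \sum_i (c i == g)%:R) = n.+1%:R^-1 * \sum_i F (c i).
  under eq_bigr do rewrite mulrCA.
  rewrite -mulr_sumr; congr (_ * _).
  under eq_bigr do rewrite mulr_sumr.
  rewrite exchange_big; apply: eq_bigr => i _ /=.
  rewrite (bigD1 (c i))//= eqxx mulr1 big1 ?addr0// => g gc.
  by rewrite eq_sym (negPf gc) mulr0.
have total : \sum_p m p = 1.
  rewrite -(pair_bigA _ (fun g g' => m (g, g')))/=.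
  under eq_bigr do rewrite rows.
  rewrite -mulr_sumr exchange_big/=.
  under eq_bigr => i _.
    rewrite (bigD1 (a i))//= eqxx big1 ?addr0; last by move=> g ga; rewrite eq_sym (negPf ga).
    over.
  by rewrite sumr_const card_ord mulVf// pnatr_eq0.
apply: (@le_trans _ _ (\sum_p (v p)%:E * lambda (A p))%E); last first.
  apply: sum_le_integral => //.
  - by apply: measurableX; exact: measurable_Q2.
  - move=> [g1 g2] [h1 h2] _ _ [z [[/= z1 z2] [/= z1' z2']]].
    by rewrite (cell_inj M0 z1 z1') (cell_inj M0 z2 z2').
  - by move=> p z [z1 z2]; split; [exact: (cell_sub M0 z1)|exact: (cell_sub M0 z2)].
  - by move=> p; rewrite le_max lexx.
  - by move=> z [z1 z2]; have /andP[] := rho2_bound z1 z2.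
  - move=> [g g'] z [/= z1 z2].
    rewrite /v ge_max; apply/andP; split.
      by have /andP[] := rho2_bound (cell_sub M0 z1) (cell_sub M0 z2).
    exact: (cell_lipschitz M0 L0 L1 L2 f01 fM1 f02 fM2 z1 z2).
have -> : (\sum_p (v p)%:E * lambda (A p))%E = (\sum_p v p * m p)%:E.
  by rewrite -sumEFin; apply: eq_bigr => p _; rewrite EFinM fineK.
rewrite lee_fin; apply: (@le_trans _ _ (\sum_p w p * m p)); last first.
  by apply: ler_sum => p _; rewrite ler_wpM2r// le_max lexx orbT.
under [leRHS]eq_bigr do rewrite /w mulrBl mulrBr mulrBl.
rewrite [leRHS]sumrB -[X in _ <= _ - X]mulr_sumr total mulr1 lerD2r [leRHS]sumrB.
have -> : \sum_p width M / (2 * L) * F p.1 * m p = width M / (2 * L) * (n.+1%:R^-1 * \sum_i F (a i)).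
  rewrite -avg mulr_sumr -(pair_bigA _ (fun g g' => width M / (2 * L) * F g * m (g, g')))/=.
  by apply: eq_bigr => g _; rewrite -mulr_sumr rows mulrA.
have -> : \sum_p width M / (2 * L) * F p.2 * m p = width M / (2 * L) * (n.+1%:R^-1 * \sum_i F (b i)).
  rewrite -avg mulr_sumr -(pair_bigA _ (fun g g' => width M / (2 * L) * F g' * m (g, g')))/= exchange_big/=.
  by apply: eq_bigr => g _; rewrite -mulr_sumr cols mulrA.
by rewrite sumrB -/F -mulrA -mulrBr -mulrBr.
Qed.

End cost.

(** The coupling which pairs the k-th points has finite cost. *)
Lemma W1_lty : (W1 (empirical_measure R x) (empirical_measure R y) < +oo)%E.
Proof.
pose xy i := (x i, y i).
apply: (@le_lt_trans _ _ (\int[empirical_measure R xy]_(z in Q2 `*` Q2) (rho2 z.1 z.2)%:E)%E).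
  apply: ereal_inf_lbound.
  by exists (empirical_measure R xy) => //; split => B mB.
set B := Num.sqrt ((2 * pi) ^+ 2 + (2 * pi) ^+ 2) : R.
apply: (@le_lt_trans _ _ (\int[empirical_measure R xy]_(z in Q2 `*` Q2) (cst B%:E z))%E).
  apply: le_integral_nonneg => z [z1 z2]; rewrite lee_fin.
    by have /andP[] := rho2_bound z1 z2.
  by have /andP[] := rho2_bound z1 z2.
have mQ : measurable ((@Q2 R) `*` (@Q2 R)) by apply: measurableX; exact: measurable_Q2.
rewrite integral_cst//.
rewrite lte_mul_pinfty// ?lee_fin ?sqrtr_ge0//.
by apply: le_lt_trans (probability_le1 _ mQ) _; rewrite ltry.
Qed.

End transport.

(** * From configurations of cells to the expectation *)

Section W1_sample.
Context {R : realType}.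

(** The distance is finite by W1_lty, so its real value inherits the lower bound that
coupling_cost gives for all couplings; both bounds in the maximum are useful, since
step functions below an integrand have to be nonnegative. *)
Lemma W1_ge n M (M0 : (0 < M)%N) (x y : 'I_n.+1 -> R * R) (a b : 'I_n.+1 -> 'I_M * 'I_M)
    (f : nat -> nat -> R) (L : R) :
  (forall i, cell (a i) (x i)) -> (forall i, cell (b i) (y i)) -> 0 < L ->
  (forall p q, `|f p.+1 q - f p q| <= L) -> (forall p q, `|f p q.+1 - f p q| <= L) ->
  (forall q, f 0%N q = 0) -> (forall q, f M q = 0) ->
  (forall p, f p 0%N = 0) -> (forall p, f p M = 0) ->
  Num.max 0 (width M / (2 * L) / n.+1%:R *
     (\sum_i (f (a i).1 (a i).2 - f (b i).1 (b i).2)) - width M) <=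
  fine (W1 (empirical_measure R x) (empirical_measure R y)).
Proof.
move=> xa yb L0 L1 L2 f01 fM1 f02 fM2.
have W0 : (0 <= W1 (empirical_measure R x) (empirical_measure R y))%E.
  apply: le_ereal_inf_tmp => _ [lambda _ <-]; apply: integral_ge0 => z _.
  by rewrite lee_fin sqrtr_ge0.
have Wfin : W1 (empirical_measure R x) (empirical_measure R y) \is a fin_num.
  by rewrite ge0_fin_numE// W1_lty.
rewrite ge_max fine_ge0//= -lee_fin fineK//.
apply: le_ereal_inf_tmp => _ [lambda lxy <-].
exact: (coupling_cost M0 xa yb L0 L1 L2 f01 fM1 f02 fM2 lxy).
Qed.

Variables (N r n : nat).
Lemma bumps_lipschitz c (lam : R) : 0 <= lam ->
  (forall k p q, `|c k p q| <= 1) ->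
  (forall k p q, c k p q != 0 -> flat (mesh N r) lam c k p q) ->
  forall x y, `|bumps (mesh N r) c N x.+1 y - bumps (mesh N r) c N x y| <= lam + 2.
Proof.
move=> lam0 c1 cf x y; rewrite (bumps_step (@meshS N r) (mesh_gt0 N r N))//.
apply: (slope_le (@meshS N r) (mesh_gt0 N r N) c1) => // k p q /cf.
by case/andP.
Qed.

Lemma bumps_boundary (c : nat -> nat -> nat -> R) x y : (grid_size N r %| x)%N ->
  bumps (mesh N r) c N x y = 0.
Proof.
move=> Mx; rewrite /bumps big1// => k _; rewrite tent_dvd ?mul0r ?mulr0//.
by apply: dvdn_trans Mx; rewrite -(side_mesh r (ltnW (ltn_ord k))) dvdn_mull.
Qed.

Lemma sample_witness (a : {ffun 'I_n + 'I_n -> 'I_(grid_size N r) * 'I_(grid_size N r)}) (lam : R) :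
  (0 < n)%N -> 1 < lam ->
  exists c : nat -> nat -> nat -> R, let f := bumps (mesh N r) c N in
  [/\ forall p q, `|f p.+1 q - f p q| <= lam + 2,
      forall p q, `|f p q.+1 - f p q| <= lam + 2,
      forall p q, (grid_size N r %| p)%N -> f p q = 0,
      forall p q, (grid_size N r %| q)%N -> f p q = 0 &
      \sum_(k < N) (\sum_(0 <= p < side k) \sum_(0 <= q < side k) wave k p q a
         - (grid_size N r)%:R * Num.sqrt n%:R * (N%:R / (lam - 1) ^+ 2))
       <= disc f a].
Proof.
move=> n0 lam1; have [c [c1 cf cD]] := stopped_disc n0 a lam1.
have lam0 : 0 <= lam by lra.
have cf' k p q : transpose c k p q != 0 -> flat (mesh N r) lam (transpose c) k p q.
  by move=> /cf; rewrite /flat andbC.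
exists c => f; split => //; first exact: bumps_lipschitz.
- move=> p q; rewrite /f -!(bumps_transpose (mesh N r) c); apply: bumps_lipschitz => //.
  by move=> k p' q'; exact: c1.
- by move=> p q Mp; exact: bumps_boundary.
- by move=> p q Mp; rewrite /f -bumps_transpose; exact: bumps_boundary.
Qed.

End W1_sample.

Section expectation.
Context {R : realType}.

(** By independence and uniformity all configurations of cells are equally likely. *)
Lemma prob_cells (n M : nat) (M0 : (0 < M)%N) d (T : measurableType d) (P : probability T R)
    (Z : 'I_n + 'I_n -> {RV P >-> (R * R)%type}) (a : {ffun 'I_n + 'I_n -> 'I_M * 'I_M}) :
  (forall i, uniform_on_Q2 (Z i)) -> mutually_independent Z ->
  P (\bigcap_(i in [set: 'I_n + 'I_n]) (Z i @^-1` cell (a i))) =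
  (#|[the finType of {ffun 'I_n + 'I_n -> 'I_M * 'I_M}]|%:R^-1)%:E.
Proof.
move=> ZU Zind.
have := Zind [set: 'I_n + 'I_n]%SET (fun i => cell (a i)) (fun i => measurable_cell (a i)).
rewrite (_ : [set` [set: 'I_n + 'I_n]%SET] = setT); last by apply/seteqP; split => i //= _; rewrite finset.in_setT.
move=> ->.
have PZ i : P (Z i @^-1` cell (a i)) = ((M%:R * M%:R)^-1)%:E.
  have [_ /(_ _ (measurable_cell (a i)))] := ZU i.
  rewrite /distribution /pushforward => ->.
  rewrite setIidl; last exact: cell_sub.
  rewrite lebesgue_cell// -EFinM; congr EFin.
  rewrite /width; have p0 := @pi_gt0 R; have Mn : M%:R != 0 :> R by rewrite pnatr_eq0 -lt0n.
  move: (@pi R) (M%:R : R) p0 Mn => p m p0 m0.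
  by field; rewrite m0 gt_eqF.
rewrite (eq_bigr (fun=> ((M%:R * M%:R)^-1)%:E)) => [|i _]; last exact: PZ.
rewrite prodEFin prodr_const cardsT; congr EFin.
by rewrite card_ffun card_prod card_ord natrX natrM exprVn.
Qed.

(** On the event that the sample has a given configuration of cells, the distance is
at least the bound given by the test function of that configuration; these events
are disjoint and have equal probabilities, so the expectation is at least the
mean of the bounds over the configurations. *)
Lemma expectation_W1_ge (N r n : nat) (lam : R) d (T : measurableType d) (P : probability T R)
    (X Y : 'I_n.+1 -> {RV P >-> (R * R)%type}) :
  (0 < r)%N -> (4 ^ N.-1 <= n.+1)%N -> 1 < lam -> (lam - 1) ^+ 2 = 2 * N%:R / wave_const ->
  (forall k, uniform_on_Q2 (X k)) -> (forall k, uniform_on_Q2 (Y k)) ->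
  mutually_independent
    (fun i : 'I_n.+1 + 'I_n.+1 => match i with inl k => X k | inr k => Y k end) ->
  ((width (grid_size N r) / (2 * (lam + 2)) / n.+1%:R *
      (N%:R * ((grid_size N r)%:R * Num.sqrt n.+1%:R) * wave_const / 2) - width (grid_size N r))%:E <=
    'E_P[fun w => fine (W1 (empirical_measure R (fun k => X k w))
                           (empirical_measure R (fun k => Y k w)))])%E.
Proof.
move=> r0 Nn lam1 lamE XU YU ind.
set Z := (fun i => _) in ind.
have ZU i : uniform_on_Q2 (Z i) by case: i => k; [exact: XU|exact: YU].
set m := grid_size N r; have m0 : (0 < m)%N by exact: grid_size_gt0.
pose sample := {ffun 'I_n.+1 + 'I_n.+1 -> 'I_m * 'I_m}.
have /choice[c cP] := fun a : sample => sample_witness a (ltn0Sn n) lam1.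
pose f (a : sample) := bumps (mesh N r) (c a) N.
pose low (a : sample) := width m / (2 * (lam + 2)) / n.+1%:R * disc (f a) a - width m.
(* A a is the event that the points of the sample lie in the cells listed by a. *)
pose A (a : sample) := \bigcap_(i in [set: 'I_n.+1 + 'I_n.+1]) (Z i @^-1` cell (a i)).
have PA a : P (A a) = (#|[the finType of sample]|%:R^-1)%:E by exact: prob_cells.
have L0 : 0 < lam + 2 by lra.
rewrite unlock.
apply: (@le_trans _ _ (\sum_a (Num.max 0 (low a))%:E * P (A a))%E); last first.
  apply: sum_le_integral => //.
  - move=> a; apply: fin_bigcap_measurable => // i _.
    rewrite -[X in measurable X]setTI; apply: measurable_funPT => //; exact: measurable_cell.
  - move=> a a' _ _ [w [wa wa']]; apply/ffunP => i.
    exact: (cell_inj m0 (wa i I) (wa' i I)).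
  - by move=> a; rewrite le_max lexx.
  - move=> w _; rewrite fine_ge0//.
    apply: le_ereal_inf_tmp => _ [lambda _ <-]; apply: integral_ge0 => z _.
    by rewrite lee_fin sqrtr_ge0.
  - move=> a w wa; have [f1 f2 f3 f4 _] := cP a.
    apply: (@W1_ge R n m m0 (X^~ w) (Y^~ w) (fun i => a (inl i)) (fun i => a (inr i))
      (f a) (lam + 2)) => //.
    + by move=> i; exact: (wa (inl i) I).
    + by move=> i; exact: (wa (inr i) I).
    + by move=> q; exact: f3.
    + by move=> q; exact: f3.
    + by move=> q; apply: f4.
    + by move=> q; apply: f4.
have -> : (\sum_a (Num.max 0 (low a))%:E * P (A a))%E =
    ((\sum_a Num.max 0 (low a)) / #|[the finType of sample]|%:R)%:E.
  by rewrite mulr_suml -sumEFin; apply: eq_bigr => a _; rewrite PA EFinM.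
have K0 : 0 < #|[the finType of sample]|%:R :> R.
  by rewrite ltr0n card_ffun card_prod card_ord expn_gt0 muln_gt0 m0.
rewrite lee_fin ler_pdivlMr//.
apply: (@le_trans _ _ (\sum_a low a)); last by apply: ler_sum => a _; rewrite le_max lexx orbT.
have cD a : \sum_(k < N) (\sum_(0 <= p < side k) \sum_(0 <= q < side k) wave k p q a
         - (grid_size N r)%:R * Num.sqrt n.+1%:R * (N%:R / (lam - 1) ^+ 2))
       <= disc (f a) a by have [] := cP a.
have := sum_stopped_disc (ltn0Sn n) r0 Nn lamE lam1 cD.
rewrite /low sumrB -mulr_sumr sumr_const -[X in _ <= _ - X]mulr_natr.
set K := #|_|%:R in K0 *; set S := \sum_a _ => h.
have w0 : 0 <= width m / (2 * (lam + 2)) / n.+1%:R.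
  by apply: divr_ge0 => //; apply: divr_ge0; [exact/ltW/width_gt0|lra].
have {}h := ler_wpM2l w0 h.
rewrite mulrBl lerD2r; apply: le_trans h.
by rewrite le_eqVlt; apply/orP; left; apply/eqP; ring.
Qed.

End expectation.

(** * Choice of the parameters *)

Lemma width_small (R : realType) (N : nat) (e : R) : 0 < e ->
  exists2 r, (0 < r)%N & width (grid_size N r) <= e.
Proof.
move=> e0; have p0 : 0 < 2 * pi / e :> R by rewrite divr_gt0// mulr_gt0// pi_gt0.
exists (Num.truncn (2 * pi / e)).+1 => //; set r := (_).+1.
have rb : 2 * pi / e < r%:R by have /andP[] := truncn_itv (ltW p0).
have M0 : 0 < (grid_size N r)%:R :> R by rewrite ltr0n grid_size_gt0.
rewrite /width ler_pdivrMr// [e * _]mulrC -ler_pdivrMr//.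
apply: le_trans (ltW rb) _; rewrite ler_nat /grid_size.
apply: leq_trans (ltnW (ltn_expl r (ltnSn 1))) _.
by rewrite leq_exp2l//; lia.
Qed.

Theorem mainTheorem2 (R : realType) :
  exists c : R, 0 < c /\
  forall n : nat, (2 <= n)%N ->
  forall (d : measure_display) (T : measurableType d) (P : probability T R)
    (X Y : 'I_n -> {RV P >-> (R * R)%type}),
  (forall k, uniform_on_Q2 (X k)) ->
  (forall k, uniform_on_Q2 (Y k)) ->
  mutually_independent
    (fun i : 'I_n + 'I_n => match i with inl k => X k | inr k => Y k end) ->
  ((c * Num.sqrt (ln n%:R / n%:R))%:E <=
    'E_P[fun w => fine (W1 (empirical_measure R (fun k => X k w))
                           (empirical_measure R (fun k => Y k w)))])%E.
Proof.
have [g gE g0] : exists2 g : R, g = wave_const & 0 < g by exists wave_const => //; exact: wave_const_gt0.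
pose C : R := 3 + Num.sqrt (2 / g).
have C0 : 0 < C by rewrite ltr_pwDl// sqrtr_ge0.
pose c1 : R := pi * g / (2 * C).
have p0 : 0 < pi :> R := pi_gt0 R.
have c10 : 0 < c1 := divr_gt0 (mulr_gt0 p0 g0) (mulr_gt0 (ltr0Sn _ 1) C0).
have c1E : c1 = pi * g / (2 * C) by []. clearbody c1.
have ln4 : 0 < ln (4 : R) by rewrite ln_gt0// ltr1n.
have l40 : 0 < Num.sqrt (ln (4 : R)) by rewrite sqrtr_gt0.
exists (c1 / 2 / Num.sqrt (ln 4)); split; first by rewrite !divr_gt0.
case=> [//|n] n2 d T P X Y XU YU ind.
(* N scales: at the finest one the blocks contain about one point of each sample. *)
pose N := (trunc_log 4 n.+1).+1.
have /andP[Nn nN] : (4 ^ N.-1 <= n.+1 < 4 ^ N)%N by exact: trunc_log_bounds.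
have N1 : 1 <= N%:R :> R by rewrite ler1n.
pose s : R := Num.sqrt N%:R; pose q : R := Num.sqrt n.+1%:R.
have s1 : 1 <= s by rewrite -(sqrtr1 R) ler_wsqrtr.
have s0 : 0 < s := lt_le_trans ltr01 s1.
have q0 : 0 < q by rewrite sqrtr_gt0 ltr0n.
have s2 : s ^+ 2 = N%:R by rewrite sqr_sqrtr.
have q2 : q ^+ 2 = n.+1%:R by rewrite sqr_sqrtr.
have e0 : 0 < c1 / 2 * (s / q) by rewrite mulr_gt0 ?divr_gt0.
(* The error due to the cells is made smaller than half of the main term. *)
have [r r0 wr] := width_small N e0.
pose lam : R := 1 + Num.sqrt (2 / g) * s.
have g20 : 0 < 2 / g by rewrite divr_gt0.
have lam1 : 1 < lam by rewrite ltrDl mulr_gt0 ?sqrtr_gt0.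
have lamE : (lam - 1) ^+ 2 = 2 * N%:R / wave_const.
  rewrite /lam addrC addKr exprMn s2 sqr_sqrtr ?(ltW g20)// -gE.
  by rewrite mulrAC.
have L0 : 0 < lam + 2 by rewrite addr_gt0// (lt_trans ltr01).
have lamC : lam + 2 <= C * s.
  by rewrite /lam /C mulrDl; lra.
apply: le_trans (expectation_W1_ge r0 Nn lam1 lamE XU YU ind).
rewrite lee_fin -/q -gE.
have M0 : 0 < (grid_size N r)%:R :> R by rewrite ltr0n grid_size_gt0.
set m := (grid_size N r)%:R in M0 *.
have wE : width (grid_size N r) = 2 * pi / m by [].
have main : c1 * (s / q) <= width (grid_size N r) / (2 * (lam + 2)) / n.+1%:R * (N%:R * (m * q) * g / 2).
  have -> : width (grid_size N r) / (2 * (lam + 2)) / n.+1%:R * (N%:R * (m * q) * g / 2) =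
      pi * g * s ^+ 2 / (2 * (lam + 2) * q).
    rewrite wE -q2 s2; field.
    by rewrite !gt_eqF.
  rewrite ler_pdivlMr; last by rewrite !mulr_gt0.
  have -> : c1 * (s / q) * (2 * (lam + 2) * q) = (pi * g * s / C) * (lam + 2).
    by rewrite c1E; field; rewrite !gt_eqF//; lra.
  have -> : pi * g * s ^+ 2 = pi * g * s / C * (C * s).
    by field; rewrite !gt_eqF//; lra.
  by rewrite ler_wpM2l// ltW// divr_gt0 ?mulr_gt0.
have half : c1 / 2 * (s / q) <= width (grid_size N r) / (2 * (lam + 2)) / n.+1%:R *
    (N%:R * (m * q) * g / 2) - width (grid_size N r).
  rewrite lerBrDr; apply: le_trans (lerD (lexx _) wr) _.
  by rewrite -mulrDl -splitr.
apply: le_trans half.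
have -> : Num.sqrt (ln n.+1%:R / n.+1%:R) = Num.sqrt (ln n.+1%:R) / q :> R.
  by rewrite sqrtrM ?ln_ge0 ?ler1n// sqrtrV.
have lnN : Num.sqrt (ln n.+1%:R) <= s * Num.sqrt (ln 4) :> R.
  rewrite -sqrtrM// ler_wsqrtr// mulr_natl -lnXn//.
  rewrite ler_ln ?posrE ?ltr0n ?exprn_gt0//.
  by rewrite -natrX ler_nat ltnW.
have -> : c1 / 2 / Num.sqrt (ln 4) * (Num.sqrt (ln n.+1%:R) / q) =
   c1 / 2 / q / Num.sqrt (ln 4) * Num.sqrt (ln n.+1%:R) by field; rewrite !gt_eqF.
have -> : c1 / 2 * (s / q) = c1 / 2 / q / Num.sqrt (ln 4) * (s * Num.sqrt (ln 4)).
  by field; rewrite !gt_eqF.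
by rewrite ler_wpM2l// !divr_ge0 ?ltW.
Qed.
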